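(* Suppose $n=\Omega(d^{2+\epsilon})$ for $\epsilon>0$, $d$ is sufficiently large, and let $\widetilde\nabla$ be any $O(d^{-2-\epsilon/8})$-approximate gradient oracle for the teacher-forcing chain-of-thought loss $L(\mathbf{W})$ of the one-layer transformer defined in the context (in fact it is only required that each component of the gradient has error at most $O(d^{-2-\epsilon/8})$). Set the initialization $\mathbf{W}^{(0)}=\boldsymbol{0}$ and learning rate $\eta=\Theta(d^{2+\epsilon/16})$. Then for any target parity $p\subseteq\{1,\dots,d\}$ with $|p|=k$, it holds with probability $1-\exp(-d^{\epsilon/2})$ over random sampling that the one-step update $$\mathbf{W}^{(1)}=\mathbf{W}^{(0)}-\eta\,\widetilde\nabla L(\mathbf{W}^{(0)})$$ achieves loss $$\|\hat{\boldsymbol{y}}_{\mathrm{test}}-\boldsymbol{y}_{\mathrm{test}}\|_\infty\le O(d^{-\epsilon/8}).$$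
   Context: Parity and its tree decomposition. Let $d\ge k\ge2$ with $k=2^v$ for an integer $v$. A subset $p=\{j_1,\dots,j_k\}\subseteq\{1,\dots,d\}$ is identified with the map $\boldsymbol{x}\mapsto\prod_{j\in p}x_j$ on $\{\pm1\}^d$. Let $d_0=d$ and $d_\ell=d+\sum_{i=1}^{\ell}2^{v-i}$ for $1\le\ell\le v$, so $d_v=d+k-1$. The intermediate parities form a complete binary tree of height $v$ with leaves $x_{j_1},\dots,x_{j_k}$ and inner nodes $x_{d+1},\dots,x_{d+k-1}$, labelled level by level upwards and left to right: every $m>d$ has two children $\mathsf{c}_1[m]<\mathsf{c}_2[m]<m$ and $x_m=x_{\mathsf{c}_1[m]}x_{\mathsf{c}_2[m]}$. Explicitly, the children of $d+i$ ($1\le i\le 2^{v-1}$) are $j_{2i-1},j_{2i}$, and for $\ell\ge2$ the children of $d_{\ell-1}+i$ ($1\le i\le2^{v-\ell}$) are $d_{\ell-2}+2i-1,\ d_{\ell-2}+2i$. Hence $x_{d+k-1}=p(\boldsymbol{x})$. Data. The samples $\boldsymbol{x}^1,\dots,\boldsymbol{x}^n$ are i.i.d. from $\mathrm{Unif}(\{\pm1\}^d)$. For $1\le j\le d+k-1$ let $\boldsymbol{x}_j=(x_j^i)_{i=1}^n\in\{\pm1\}^n$ collect the $j$-th (input or ground-truth intermediate) bit of all samples. Link function. $\phi:[-1,1]\to[-1,1]$ is a fixed function, applied coordinatewise, with $\phi(0)=-1$, $\phi(\pm1)=1$, $\phi'(0)=\phi'(\pm1)=0$, assumed symmetric and sufficiently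 regular, so that one may expand $\phi(t)=-1+ct^2+O(|t|^4)$ and $\phi'(t)=2ct+O(|t|^3)$. Transformer. The trainable weights are $\mathbf{W}=(w_{j,m})$ with $d+1\le m\le d+k-1$ and $1\le j\le m-1$ (all other entries of the $(d+k-1)\times(d+k-1)$ attention matrix are causally masked to $-\infty$). The softmax scores are $\sigma_j(\boldsymbol{w}_m)=e^{w_{j,m}}/\sum_{\alpha=1}^{m-1}e^{w_{\alpha,m}}$ for $1\le j\le m-1$. Training loss (teacher forcing: ground-truth preceding states are fed in): $$L(\mathbf{W})=\frac1{2n}\sum_{m=d+1}^{d+k-1}\|\hat{\boldsymbol{x}}_m-\boldsymbol{x}_m\|^2,\qquad \hat{\boldsymbol{x}}_m=\phi\Bigl(\sum_{j=1}^{m-1}\sigma_j(\boldsymbol{w}_m)\boldsymbol{x}_j\Bigr).$$ Inference (no ground-truth labels). Test inputs with bit vectors $\boldsymbol{x}_1,\dots,\boldsymbol{x}_d$ ($\pm1$-valued, one coordinate per test input) are randomly generated; set $\hat{\boldsymbol{x}}_j=\boldsymbol{x}_j$ for $j\le d$ and recursively $\hat{\boldsymbol{x}}_m=\phi(\sum_{j=1}^{m-1}\sigma_j(\boldsymbol{w}_m)\hat{\boldsymbol{x}}_j)$ for $m=d+1,\dots,d+k-1$, with the weights $\mathbf{W}=\mathbf{W}^{(1)}$. The prediction is $\hat{\boldsymbol{y}}_{\mathrm{test}}=\hat{\boldsymbol{x}}_{d+k-1}$ and the truth is $\boldsymbol{y}_{\mathrm{test}}=p(\boldsymbol{x}_1,\dots,\boldsymbol{x}_d)$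 (coordinatewise). Oracle. An $\varepsilon$-approximate gradient oracle returns, for any query $\mathbf{W}$, a (possibly adversarially chosen) $\widetilde\nabla L(\mathbf{W})$ with $\|\widetilde\nabla L(\mathbf{W})-\nabla L(\mathbf{W})\|_2\le\varepsilon$. Asymptotic notation is as $d\to\infty$.
   Formalization: The quadratic coefficient c in the expansion φ(t) = −1 + ct² + O(|t|⁴) is assumed positive; with c = 0 (e.g. φ(t) = −1 + 4t⁴ − 2t⁸, k = 2, ε = 1, exact gradient) the claim fails. *)

(* Defs.v *)
From HB Require Import structures.
From mathcomp Require Import all_boot all_order all_algebra.
From mathcomp Require Import zify.
From mathcomp Require Import all_classical all_reals all_analysis.
Import Order.TTheory GRing.Theory Num.Theory.
Import numFieldNormedType.Exports.

Set Implicit Arguments.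
Unset Strict Implicit.
Unset Printing Implicit Defensive.

Local Open Scope classical_set_scope.
Local Open Scope ring_scope.

(** Conventions.  Nodes are numbered from 0: the inputs are 0, ..., d-1 and the
    inner nodes d, ..., d+k-2, so that node [m] here is node [m + 1] in 1-based
    numbering.  A boolean [b] encodes the bit (-1)^b, and a sample of size [n]
    is a matrix in ['M[bool]_(n, d)], one row per data point. *)

Section Link.
Variable R : realType.

(** [phi] is only constrained on [-1, 1]; its derivative [dphi] is the limit of
    difference quotients within [-1, 1], hence one-sided at the endpoints.
    "Sufficiently regular" means that the derivative is Lipschitz and that the
    two expansions hold at 0.  Since [phi] and [dphi] are bounded on [-1, 1],
    stating the O(.) bounds on all of [-1, 1] is the same as stating them near 0.
    The quadratic coefficient [c] is nonzero, hence positive as phi >= -1. *)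
Record link_function (phi dphi : R -> R) (c : R) : Prop := LinkFunction {
  link_range : forall t : R, t \in `[-1, 1] -> phi t \in `[-1, 1] ;
  link_even : forall t : R, t \in `[-1, 1] -> phi (- t) = phi t ;
  link_0 : phi 0 = -1 ;
  link_1 : phi 1 = 1 ;
  link_N1 : phi (-1) = 1 ;
  link_deriv : forall t : R, t \in `[-1, 1] ->
    (phi s - phi t) / (s - t) @[s --> within `[-1, 1] t^'] --> dphi t ;
  link_d0 : dphi 0 = 0 ;
  link_d1 : dphi 1 = 0 ;
  link_dN1 : dphi (-1) = 0 ;
  link_dlip : exists K : R, forall s t : R, s \in `[-1, 1] -> t \in `[-1, 1] ->
    `|dphi s - dphi t| <= K * `|s - t| ;
  link_c_gt0 : 0 < c ;
  link_expand : exists K : R, forall t : R, t \in `[-1, 1] ->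
    `|phi t - (-1 + c * t ^+ 2)| <= K * `|t| ^+ 4 ;
  link_dexpand : exists K : R, forall t : R, t \in `[-1, 1] ->
    `|dphi t - 2 * c * t| <= K * `|t| ^+ 3 }.

End Link.

(** [unif_prob E] is the probability of [E] under the uniform law on [T].  For
    T = 'M[bool]_(n, d) this is the law of n i.i.d. uniform points of {±1}^d. *)
Definition unif_prob (R : realType) (T : finType) (E : T -> Prop) : R :=
  #|[pred x | `[< E x >]]|%:R / #|T|%:R.

Section Tree.
Variables (d k : nat) (js : seq 'I_d).

(** [js] lists the k = 2^v leaves.  Put the leaves and the inner nodes in one
    list, leaves first; the r-th inner node is at position k + r, and because k
    is a power of 2 its children are at positions 2r and 2r + 1 (see [child_leaf]
    and [child_inner] for the level-by-level description). *)
Definition child (b : bool) (m : nat) : nat :=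
  nth 0%N ([seq val j | j <- js] ++ iota d k.-1) ((m - d).*2 + b).

End Tree.

(** Number of nodes up to and including level [l]. *)
Definition level_end (d v l : nat) : nat :=
  (d + \sum_(1 <= i < l.+1) 2 ^ (v - i))%N.

Lemma level_endE (d v l : nat) : (l <= v)%N ->
  (level_end d v l + 2 ^ (v - l) = d + 2 ^ v)%N.
Proof.
rewrite /level_end; elim: l => [|l IHl] lv.
  by rewrite big_geq // addn0 subn0.
rewrite big_nat_recr //= -(IHl (ltnW lv)) -!addnA; congr (_ + (_ + _))%N.
by rewrite (_ : v - l = (v - l.+1).+1)%N ?expnS ?mul2n -?addnn // subnSK.
Qed.

Lemma child_leaf (d v : nat) (js : seq 'I_d) (b : bool) (i : nat) (j0 : 'I_d) :
  size js = (2 ^ v)%N -> (0 < v)%N -> (i < 2 ^ v.-1)%N ->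
  child (2 ^ v) js b (d + i) = nth j0 js (i.*2 + b).
Proof.
move=> sjs v0 iv; rewrite /child addKn nth_cat size_map sjs.
have lt : (i.*2 + b < 2 ^ v)%N.
  rewrite -(prednK v0) expnS mul2n; apply: (@leq_trans (i.+1).*2).
    by rewrite doubleS; case: b; rewrite ?addn1 ?addn0.
  by rewrite leq_double.
by rewrite lt (nth_map j0) ?sjs.
Qed.

Lemma child_inner (d v l : nat) (js : seq 'I_d) (b : bool) (i : nat) :
  size js = (2 ^ v)%N -> (2 <= l <= v)%N -> (i < 2 ^ (v - l))%N ->
  child (2 ^ v) js b (level_end d v l.-1 + i) = (level_end d v l.-2 + i.*2 + b)%N.
Proof.
case: l => [|[|l]]//= sjs lv iv.
have E1 := level_endE d (ltnW lv); have E0 := level_endE d (ltnW (ltnW lv)).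
have S1 : (2 ^ (v - l) = (2 ^ (v - l.+1)).*2)%N.
  by rewrite -mul2n -expnS subnSK // ltnW.
have S2 : (2 ^ (v - l.+1) = (2 ^ (v - l.+2)).*2)%N.
  by rewrite -mul2n -expnS subnSK.
have D0 : (d <= level_end d v l)%N by rewrite /level_end leq_addr.
have D1 : (d <= level_end d v l.+1)%N by rewrite /level_end leq_addr.
have Q0 : (0 < 2 ^ v)%N by rewrite expn_gt0.
move: E1 E0 S1 S2 D0 D1 Q0 iv; rewrite /child nth_cat size_map sjs.
set a1 := level_end d v l.+1; set a0 := level_end d v l; set q := (2 ^ v)%N.
set q0 := (2 ^ (v - l))%N; set q1 := (2 ^ (v - l.+1))%N.
set q2 := (2 ^ (v - l.+2))%N => E1 E0 S1 S2 D0 D1 Q0 iv.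
have P : ((a1 + i - d).*2 + b = q + (a0 - d + i.*2 + b))%N by lia.
rewrite P ltnNge leq_addr /= addKn nth_iota; last by case: (b) => /=; lia.
by rewrite !addnA subnKC.
Qed.

Section Model.
Variables (R : realType) (d k : nat).

Local Notation N := (d + k.-1)%N.

Definition sgn (b : bool) : R := (-1) ^+ b.

Definition input_bits (n : nat) (X : 'M[bool]_(n, d)) (i : 'I_n) : seq R :=
  [seq sgn (X i j) | j <- enum 'I_d].

(** Autoregressive generation: starting from the inputs, the state of each node
    m = d, ..., N - 1 in turn is computed from the list of all preceding ones. *)
Definition generate (next : 'I_N -> seq R -> R) (s0 : seq R) : seq R :=
  foldl (fun s m => rcons s (next m s)) s0 [seq m : 'I_N <- enum 'I_N | (d <= m)%N].

Definition true_states (js : seq 'I_d) : seq R -> seq R :=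
  generate (fun m s => s`_(child k js false m) * s`_(child k js true m)).

Definition parity (p : {set 'I_d}) (n : nat) (X : 'M[bool]_(n, d)) : 'rV[R]_n :=
  \row_i \prod_(j in p) sgn (X i j).

(** The entry [W j m] is the weight w_{j,m}; only the entries with j < m and
    d <= m are used, all others are masked. *)
Definition softmax (W : 'M[R]_N) (j m : 'I_N) : R :=
  expR (W j m) / \sum_(a < N | (a < m)%N) expR (W a m).

Definition next_token (phi : R -> R) (W : 'M[R]_N) (m : 'I_N) (s : seq R) : R :=
  phi (\sum_(j < N | (j < m)%N) softmax W j m * s`_j).

Definition loss (phi : R -> R) (js : seq 'I_d) (n : nat) (X : 'M[bool]_(n, d))
    (W : 'M[R]_N) : R :=
  (2 * n%:R)^-1 * \sum_(m < N | (d <= m)%N) \sum_(i < n)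
    (let x := true_states js (input_bits X i) in
     next_token phi W m x - x`_m) ^+ 2.

Definition predict (phi : R -> R) (W : 'M[R]_N) (n : nat)
    (X : 'M[bool]_(n, d)) : 'rV[R]_n :=
  \row_i (generate (next_token phi W) (input_bits X i))`_N.-1.

Definition grad (L : 'M[R]_N -> R) (W : 'M[R]_N) : 'M[R]_N :=
  \matrix_(j, m) 'D_(delta_mx j m) (L : _ -> R^o) W.

(** Errors are measured on the trainable (unmasked) entries only. *)
Definition grad_oracle (delta : R) (L : 'M[R]_N -> R) (G : 'M[R]_N -> 'M[R]_N) :=
  forall W, Num.sqrt (\sum_(m < N | (d <= m)%N) \sum_(j < N | (j < m)%N)
    (G W j m - grad L W j m) ^+ 2) <= delta.

Definition entrywise_grad_oracle (delta : R) (L : 'M[R]_N -> R)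
    (G : 'M[R]_N -> 'M[R]_N) :=
  forall W (j m : 'I_N), (d <= m)%N -> (j < m)%N ->
    `|G W j m - grad L W j m| <= delta.

Definition one_step (eta : R) (G : 'M[R]_N -> 'M[R]_N) : 'M[R]_N :=
  0 - eta *: G 0.

End Model.

Arguments one_step {R d k}.

(* Main.v *)
From HB Require Import structures.
Require Import Defs.
From mathcomp Require Import all_boot all_order all_algebra.
From mathcomp Require Import zify ring lra.
From mathcomp Require Import all_classical all_reals all_analysis.
Import Order.TTheory GRing.Theory Num.Theory.
Import numFieldNormedType.Exports.
Local Open Scope ring_scope.

(** At W = 0 all attention scores are uniform, so the (j, m) entry of the gradient
    is 1/m times the sample mean of (phi z - x_m) phi'(z) (x_j - z), where z is the
    average of the m states preceding x_m.  These summands are bounded, so by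
    Hoeffding's inequality all entries are within O(d^(-2 - eps/8)) of their
    expectations, outside an event of probability exp(-d^(eps/2)).

    Up to a term independent of j, the leading part -2c (1 + x_m) z (x_j - z) has
    mean -2c/m if j is a child of m and 0 otherwise: for a, b < m, the product
    x_a x_b has mean 0 unless a = b, and x_m x_a x_b has mean 0 unless {a, b} are
    the children of m.  The remainder is O(E|z|^3) = O(m^(-3/2)), because the left
    (resp. right) children in the tree are mutually independent signs, whence
    E z^4 = O(m^(-2)).  The expectations for the two children of m agree exactly,
    since exchanging their subtrees preserves z and x_m; no expansion would give
    this for large eps.

    Hence after one step the logits of the children of m exceed all the others by
    a multiple of d^(eps/16) and differ by O(d^(-eps/16)), so that attention is
    the average of the children up to alpha = O(d^(-eps/16)).  At these averages,
    which lie in {-1, 0, 1}, phi gives the product of the children and has a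
    vanishing derivative; an error rho in the children thus becomes at most
    4K (alpha + rho)^2, and rho = 16 K alpha^2 is stable along the tree. *)

Set Implicit Arguments.
Unset Strict Implicit.

(** * Generation and binary heaps *)

(** The fold only appends. When the indices are consecutive from [size s0], the state of m lands at
    position m, and the list that [next m] saw is a prefix of the final one. *)
Lemma foldl_rcons_nth (R : realType) (M : nat) (next : 'I_M -> seq R -> R)
    (l : seq 'I_M) (s0 : seq R) :
  map val l = iota (size s0) (size l) ->
  let s := foldl (fun s m => rcons s (next m s)) s0 l in
  [/\ size s = (size s0 + size l)%N,
      take (size s0) s = s0 &
      forall m, m \in l -> s`_m = next m (take m s)].
Proof.
elim: l s0 => [|a l IH] s0 /= E; first by rewrite addn0 take_size.
case: E => Ea El.
have := IH (rcons s0 (next a s0)); rewrite size_rcons => /(_ El) [].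
set s := foldl _ _ _ => sz tk nx.
have tk0 : take (size s0) s = s0.
  have := congr1 (take (size s0)) tk.
  by rewrite take_takel // -cats1 take_size_cat.
split; [by rewrite sz addSnnS| exact: tk0 |].
move=> m; rewrite inE => /orP[/eqP ->|]; last exact: nx.
rewrite /= in Ea; rewrite Ea tk0 -(nth_take (n0 := (size s0).+1)) // tk.
by rewrite nth_rcons ltnn eqxx.
Qed.

Lemma val_filter_geq (n d : nat) :
  map val [seq m : 'I_n <- enum 'I_n | (d <= m)%N] = iota d (n - d).
Proof.
rewrite -[RHS](_ : [seq i <- iota 0 n | (d <= i)%N] = _).
  by rewrite -val_enum_ord filter_map.
have [dn|nd] := leqP d n; last first.
  rewrite (eqP (ltnW nd : (n - d == 0)%N)) /=; apply/eqP; rewrite -(negbK (_ == _)) -has_filter.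
  by apply/hasPn => x; rewrite mem_iota; lia.
rewrite -{1}(subnKC dn) iotaD filter_cat add0n.
rewrite (_ : [seq i <- iota 0 d | _] = [::]); last first.
  apply/eqP; rewrite -(negbK (_ == _)) -has_filter.
  by apply/hasPn => x; rewrite mem_iota; lia.
by rewrite cat0s; apply/all_filterP/allP => x; rewrite mem_iota; lia.
Qed.

Lemma generateP (R : realType) (d k : nat)
    (next : 'I_(d + k.-1) -> seq R -> R) (s0 : seq R) :
  size s0 = d ->
  let s := generate next s0 in
  [/\ size s = (d + k.-1)%N, forall j, (j < d)%N -> s`_j = s0`_j &
      forall m : 'I_(d + k.-1), (d <= m)%N -> s`_m = next m (take m s)].
Proof.
move=> sz; rewrite /generate; set l := [seq _ <- _ | _].
have Em : map val l = iota d k.-1 by rewrite val_filter_geq addKn.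
have szl : size l = k.-1 by rewrite -(size_map val) Em size_iota.
have := @foldl_rcons_nth R _ next l s0; rewrite sz szl => /(_ Em).
set s := foldl _ _ _ => -[s1 s2 s3]; split => // [j jd|m dm].
  by rewrite -s2 nth_take.
by apply: s3; rewrite mem_filter dm mem_enum.
Qed.

(** Recursion from the root towards the leaves. Halving is not structural, so fuel is used; [hfE]
    shows that any fuel of at least H gives the same value. *)
Lemma heap_rec (T : Type) (a : T) (F : nat -> T -> T) :
  exists h : nat -> T, h 1%N = a /\ forall H, (2 <= H)%N -> h H = F H (h H./2).
Proof.
pose hf := fix hf n H := if n is n'.+1 then
  if (H <= 1)%N then a else F H (hf n' H./2) else a.
have hfE : forall n H, (H <= n)%N -> hf n H = hf H H.
  elim/ltn_ind => -[|n] IH [|[|H]] // lHn.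
  have lH : (H.+2./2 <= H.+1)%N by lia.
  rewrite -[LHS]/(F H.+2 (hf n H.+2./2)) -[RHS]/(F H.+2 (hf H.+1 H.+2./2)).
  by rewrite (IH n) ?(IH H.+1) //; lia.
exists (fun H => hf H H); split => // -[|[|H]] // _.
rewrite -[LHS]/(F H.+2 (hf H.+1 H.+2./2)) hfE //; lia.
Qed.

(** In a labelling where every node is the xor of its children, the root and all children on side
    [b] can be chosen freely: the other child of H is forced to be [h H (+) g H]. *)
Lemma heap_parity (b r : bool) (g : nat -> bool) :
  exists h : nat -> bool, [/\ h 1%N = r,
    forall H, (0 < H)%N -> h H = h H.*2 (+) h H.*2.+1 &
    forall H, (0 < H)%N -> h (b + H.*2)%N = g H].
Proof.
have [h [h1 hS]] := heap_rec r
  (fun H p => if odd H == b then g H./2 else p (+) g H./2).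
have hb H : (0 < H)%N -> h (b + H.*2)%N = g H.
  move=> H0; rewrite hS; last by lia.
  by rewrite oddD odd_double addbF oddb eqxx half_bit_double.
have hn H : (0 < H)%N -> h (~~ b + H.*2)%N = h H (+) g H.
  move=> H0; rewrite hS; last by lia.
  by rewrite oddD odd_double addbF oddb half_bit_double; case: (b).
exists h; split => // H H0.
have := hb H H0; have := hn H H0.
by case: b {hS hb hn} => /= -> ->; case: (h H); case: (g H).
Qed.

(* The involution of the infinite heap that exchanges the subtrees hanging
   below the two children of M. *)
Lemma heap_swap (M : nat) : (0 < M)%N ->
  exists f : nat -> nat, [/\ forall H, (0 < H)%N -> f (f H) = H /\ (M < f H)%N = (M < H)%N,
    forall e H, (0 < H)%N -> (2 ^ e <= f H)%N = (2 ^ e <= H)%N,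
    forall H, (0 < H)%N -> H != M -> f H.*2 = (f H).*2 /\ f H.*2.+1 = (f H).*2.+1,
    forall H, (0 < H <= M)%N -> f H = H &
    f M.*2 = M.*2.+1 /\ f M.*2.+1 = M.*2].
Proof.
move=> M0.
(* Indices below 2M are fixed, the two children of M trade places, and each later index keeps its
   last bit while its parent is mapped. Hence subtrees move rigidly and levels are preserved. *)
have [f [f1 fS]] := heap_rec 1%N (fun H p => if (H < M.*2)%N then H else
  if H == M.*2 then M.*2.+1 else if H == M.*2.+1 then M.*2 else (odd H + p.*2)%N).
have fl H : (0 < H < M.*2)%N -> f H = H.
  case: H => [|[|H]] // lH; rewrite fS //.
  by move: lH => /= ->.
have fM : f M.*2 = M.*2.+1 by rewrite fS ?ltnn ?eqxx //; lia.
have fM1 : f M.*2.+1 = M.*2.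
  rewrite fS; last by lia.
  by rewrite ltnNge leqnSn /= eqxx; case: eqP => //; lia.
have fB H : (M.*2.+1 < H)%N -> f H = (odd H + (f H./2).*2)%N.
  move=> lH; rewrite fS; last by lia.
  by rewrite ifN ?ifN ?ifN //; lia.
have main H : (0 < H)%N -> f (f H) = H /\ (M < f H)%N = (M < H)%N.
  elim/ltn_ind: H => H IH H0.
  have [lH|] := ltnP H M.*2; first by rewrite !fl ?lH ?H0.
  rewrite leq_eqVlt => /orP[/eqP<-|]; first by rewrite fM fM1; split => //; lia.
  rewrite leq_eqVlt => /orP[/eqP<-|]; first by rewrite fM1 fM; split => //; lia.
  move=> lH; have [||i1 i2] := IH H./2; [lia|lia|].
  rewrite (_ : (M < H./2)%N) in i2; last by lia.
  have E := fB _ lH; split; last by rewrite E; lia.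
  rewrite fB; last by rewrite E; lia.
  rewrite E half_bit_double i1 oddD odd_double addbF oddb; exact: odd_double_half.
exists f; split => //.
- move=> e H; elim/ltn_ind: H e => H IH e H0.
  have [lH|] := ltnP H M.*2; first by rewrite fl ?lH ?H0.
  have M2 e' : (2 ^ e' <= M.*2.+1)%N = (2 ^ e' <= M.*2)%N.
    case: e' => [|e']; first by rewrite expn0; lia.
    by rewrite expnS; lia.
  rewrite leq_eqVlt => /orP[/eqP<-|]; first by rewrite fM M2.
  rewrite leq_eqVlt => /orP[/eqP<-|]; first by rewrite fM1 M2.
  move=> lH; rewrite (fB _ lH); case: e => [|e].
    have [|_ ] := main H./2; first by lia.
    by rewrite expn0; lia.
  have := IH H./2; rewrite expnS => /(_ _ e); lia.
- move=> H H0 HM; have [lH|lH] := ltnP H M; first by rewrite !fl; lia.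
  have l1 : (M.*2.+1 < H.*2)%N by lia.
  rewrite (fB _ l1) (fB _ (leqW l1)) /= odd_double /= uphalf_double doubleK.
  by split; lia.
- by move=> H lH; apply: fl; lia.
Qed.

(** * The states of the parity tree *)

Lemma sgnD (R : realType) (a b : bool) : sgn R (a (+) b) = sgn R a * sgn R b.
Proof. by rewrite /sgn signr_addb. Qed.

Section ParityTree.
Variables (R : realType) (d k : nat) (js : seq 'I_d).
Hypotheses (sjs : size js = k) (ujs : uniq js) (k2 : (2 <= k)%N).

Local Notation N := (d + k.-1)%N.

Definition state (y : 'rV[bool]_d) (j : nat) : R :=
  (true_states k js (input_bits R y ord0))`_j.

Definition tree_nodes : seq nat := [seq val j | j <- js] ++ iota d k.-1.

(* Heap numbering of the tree: 1 is the root, the children of H are 2H and 2H + 1,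
   and the leaves are k, ..., 2k - 1. *)
Definition hnode (H : nat) : nat := nth 0%N tree_nodes (k.*2.-1 - H).

Definition hstate (y : 'rV[bool]_d) (H : nat) : R := state y (hnode H).

Lemma state_input y (j : 'I_d) : state y j = sgn R (y ord0 j).
Proof.
have sz : size (input_bits R y ord0) = d by rewrite size_map size_enum_ord.
have [_ E _] := generateP (k := k)
  (fun m s => s`_(child k js false m) * s`_(child k js true m)) sz.
rewrite /state /true_states E //.
by rewrite (nth_map j) ?size_enum_ord // nth_ord_enum.
Qed.

Lemma nth_leaf_lt q : (q < k)%N -> (nth 0%N tree_nodes q < d)%N.
Proof.
move=> qk; rewrite nth_cat size_map sjs qk.
have /mapP[j _ ->] : nth 0%N [seq val j | j <- js] q \in [seq val j | j <- js].
  by rewrite mem_nth // size_map sjs.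
exact: ltn_ord.
Qed.

Lemma nth_inner q : (k <= q < k.*2.-1)%N -> nth 0%N tree_nodes q = (d + (q - k))%N.
Proof.
by move=> lq; rewrite nth_cat size_map sjs ltnNge; case/andP: (lq) => -> _ /=;
  rewrite nth_iota //; lia.
Qed.

Lemma child_lt b m : (d <= m < N)%N -> (child k js b m < m)%N.
Proof.
move=> lm; rewrite /child -/tree_nodes.
have [lk|lk] := ltnP ((m - d).*2 + b)%N k; first by have := nth_leaf_lt lk; lia.
by rewrite nth_inner; case: b lk => /=; lia.
Qed.

Lemma state_inner y m : (d <= m < N)%N ->
  state y m = state y (child k js false m) * state y (child k js true m).
Proof.
move=> lm; have sz : size (input_bits R y ord0) = d by rewrite size_map size_enum_ord.
have lmN : (m < N)%N by lia.
have [_ _ E] := generateP (k := k)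
  (fun m s => s`_(child k js false m) * s`_(child k js true m)) sz.
rewrite /state /true_states (E (Ordinal lmN)) /=; last by lia.
by rewrite !nth_take ?child_lt.
Qed.

Lemma hnode_leaf (j0 : 'I_d) H : (k <= H < k.*2)%N ->
  hnode H = nth j0 js (k.*2.-1 - H).
Proof.
move=> lH; rewrite /hnode nth_cat size_map sjs ifT; last by lia.
by rewrite (nth_map j0) // sjs; lia.
Qed.

Lemma hnode_inner H : (0 < H < k)%N -> hnode H = (N - H)%N.
Proof. by move=> lH; rewrite /hnode nth_inner; lia. Qed.

(** Heap indices run through [tree_nodes] backwards, so the left child ([false]) is the one with odd
    index 2H + 1. *)
Lemma hnode_child (b : bool) H : (0 < H < k)%N ->
  hnode (b + H.*2)%N = child k js (~~ b) (hnode H).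
Proof.
move=> lH; rewrite (hnode_inner lH) /child -/tree_nodes /hnode.
by congr nth; case: b => /=; lia.
Qed.

Lemma hstate_inner y H : (0 < H < k)%N ->
  hstate y H = hstate y H.*2 * hstate y H.*2.+1.
Proof.
move=> lH; rewrite /hstate [LHS]state_inner; last by rewrite hnode_inner; lia.
by rewrite -[H.*2.+1]/(true + H.*2)%N -[H.*2]/(false + H.*2)%N !hnode_child //= mulrC.
Qed.

Lemma tree_nodes_uniq : uniq tree_nodes.
Proof.
rewrite cat_uniq map_inj_uniq ?ujs ?iota_uniq ?andbT //=; last exact: val_inj.
by apply/hasPn => x; rewrite mem_iota => lx; apply/mapP => -[j _ Ej];
  have := ltn_ord j; lia.
Qed.

Lemma size_tree_nodes : size tree_nodes = k.*2.-1.
Proof. by rewrite size_cat size_map size_iota sjs; lia. Qed.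

Definition hidx (j : nat) : nat := (k.*2.-1 - index j tree_nodes)%N.

Lemma hnodeK H : (0 < H < k.*2)%N -> hidx (hnode H) = H.
Proof.
move=> lH; rewrite /hidx /hnode index_uniq ?tree_nodes_uniq ?size_tree_nodes //; lia.
Qed.

Lemma hidx_bound j : j \in tree_nodes -> (0 < hidx j < k.*2)%N.
Proof. by rewrite -index_mem size_tree_nodes /hidx; lia. Qed.

Lemma hidxK j : j \in tree_nodes -> hnode (hidx j) = j.
Proof.
move=> jt; have := jt; rewrite -index_mem size_tree_nodes => lj.
by rewrite /hnode /hidx subKn ?nth_index //; lia.
Qed.

Lemma hnode_tree H : (0 < H < k.*2)%N -> hnode H \in tree_nodes.
Proof. by move=> lH; rewrite mem_nth // size_tree_nodes; lia. Qed.

Lemma inner_tree m : (d <= m < N)%N -> m \in tree_nodes.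
Proof. by move=> lm; rewrite mem_cat mem_iota; lia. Qed.

Lemma leaf_tree (i : 'I_d) : (val i \in tree_nodes) = (i \in js).
Proof.
rewrite mem_cat mem_iota mem_map; last exact: val_inj.
by have := ltn_ord i; case: (i \in js) => //=; lia.
Qed.

Lemma hidx_inner m : (d <= m < N)%N -> hidx m = (N - m)%N.
Proof.
move=> lm; rewrite -[in LHS](_ : hnode (N - m) = m) ?hnodeK //; first by lia.
by rewrite hnode_inner; lia.
Qed.

(** The leaves occur in [js] in arbitrary order, so the reversal of order between node numbers and
    heap indices is only claimed against an inner node. *)
Lemma hidx_lt j m : (d <= m < N)%N -> j \in tree_nodes ->
  (j < m)%N = (hidx m < hidx j)%N.
Proof.
move=> lm jt; rewrite hidx_inner //; have [jd|jd] := ltnP j d.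
  have := jt; rewrite mem_cat mem_iota; case/orP => [/mapP[i ij ji]|]; last by lia.
  rewrite /hidx index_cat ji map_f // index_map; last exact: val_inj.
  by have := ij; rewrite -index_mem sjs; have := ltn_ord i; lia.
have jN : (j < N)%N.
  move: jt; rewrite mem_cat mem_iota; case/orP => [/mapP[i ij ->]|]; last by lia.
  by rewrite /=; have := ltn_ord i; lia.
by rewrite hidx_inner; lia.
Qed.

Lemma heap_up_ind (P : nat -> Prop) :
  (forall H, (k <= H < k.*2)%N -> P H) ->
  (forall H, (0 < H < k)%N -> P H.*2 -> P H.*2.+1 -> P H) ->
  forall H, (0 < H < k.*2)%N -> P H.
Proof.
move=> Pl Pi H; have [n] := ubnP (k.*2 - H); elim: n H => // n IH H ln lH.
have [lk|lk] := ltnP H k; last by apply: Pl; lia.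
by apply: Pi; [lia| |]; apply: IH; lia.
Qed.

(** * Translations of the cube that flip prescribed states *)

Definition xorv (y u : 'rV[bool]_d) : 'rV[bool]_d :=
  \row_j (y ord0 j (+) u ord0 j).

Lemma xorvK u : involutive (xorv^~ u).
Proof. by move=> y; apply/rowP => j; rewrite !mxE -addbA addbb addbF ord1. Qed.

Lemma j0P : exists j0 : 'I_d, j0 \in js.
Proof.
by move: sjs k2; case: js => [|j s]; [move=> <-|move=> *; exists j; rewrite inE eqxx].
Qed.

Lemma nontree_input j : (j < N)%N -> j \notin tree_nodes ->
  exists2 i : 'I_d, j = i & i \notin js.
Proof.
move=> jN jt; have jd : (j < d)%N.
  by rewrite ltnNge; apply: contra jt => dj; apply: inner_tree; lia.
by exists (Ordinal jd) => //; rewrite -leaf_tree.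
Qed.

Lemma node_ind (P : nat -> Prop) :
  (forall j : 'I_d, P j) ->
  (forall m, (d <= m < N)%N -> P (child k js false m) -> P (child k js true m) -> P m) ->
  forall j, (j < N)%N -> P j.
Proof.
move=> Pj Pm; elim/ltn_ind => j IH jN.
have [jd|jd] := ltnP j d; first exact: Pj (Ordinal jd).
have lj : (d <= j < N)%N by lia.
by apply: Pm => //; apply: IH; have := child_lt false lj; have := child_lt true lj; lia.
Qed.

(** Every state is a product of input bits, thus a character of the group of sign vectors. A product
    of states has mean 0 as soon as some translation u gives it the value -1. *)
Lemma stateM y u j : (j < N)%N -> state (xorv y u) j = state y j * state u j.
Proof.
elim/node_ind => [i|m lm E1 E2]; first by rewrite !state_input mxE sgnD.
by rewrite 3?[state _ m]state_inner // E1 E2 mulrACA.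
Qed.

Lemma state_sqr y j : (j < N)%N -> state y j ^+ 2 = 1.
Proof.
elim/node_ind => [i|m lm E1 E2]; first by rewrite state_input /sgn sqrr_sign.
by rewrite state_inner // exprMn E1 E2 mulr1.
Qed.

(** A consistent labelling is determined by its leaves, so it suffices to use the leaf labels as
    input bits and [false] at the other inputs. *)
Lemma hstate_realize (h : nat -> bool) :
  (forall H, (0 < H < k)%N -> h H = h H.*2 (+) h H.*2.+1) ->
  exists u : 'rV[bool]_d, (forall H, (0 < H < k.*2)%N -> hstate u H = sgn R (h H)) /\
    forall i : 'I_d, i \notin js -> u ord0 i = false.
Proof.
move=> hE; have [j0 _] := j0P.
exists (\row_i ((i \in js) && h (k.*2.-1 - index i js)%N)); split; last first.
  by move=> i /negPf ni; rewrite mxE ni.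
apply: heap_up_ind => [H lH|H lH E1 E2].
  rewrite /hstate (hnode_leaf j0) // state_input mxE mem_nth; last by rewrite sjs; lia.
  by rewrite index_uniq ?sjs //=; [congr (sgn _ (h _))|]; lia.
by rewrite hstate_inner // E1 E2 (hE H lH) sgnD.
Qed.

(** Take all free labels of [heap_parity] to be false except that of the child of P on side [b].
    Since P itself has label false, its other child must flip too, while nothing before 2P
    changes. *)
Lemma hstate_flip (b : bool) P : (0 < P < k)%N -> exists u : 'rV[bool]_d,
  [/\ hstate u P.*2 = -1 /\ hstate u P.*2.+1 = -1,
      forall H, (0 < H < P.*2)%N -> hstate u H = 1,
      forall H, (1 < H < k.*2)%N -> odd H = b -> H != (b + P.*2)%N -> hstate u H = 1 &
      forall i : 'I_d, i \notin js -> u ord0 i = false].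
Proof.
move=> lP; have [h [h1 hS hb]] := heap_parity b false (fun H => H == P).
have [|u [uE uj]] := @hstate_realize h; first by move=> H lH; apply: hS; lia.
have h0 H : (0 < H < P.*2)%N -> h H = false.
  elim/ltn_ind: H => H IH lH; case: (ltnP H 2) => [H1|H2].
    by rewrite (_ : H = 1%N) //; lia.
  have e1 := hb H./2; have e2 := hS H./2.
  have e3 : h H./2 = false by apply: IH; lia.
  have e0 : (H./2 == P) = false by rewrite /=; lia.
  have : h H./2.*2 = false /\ h H./2.*2.+1 = false.
    move: e1 e2; rewrite e0 e3; case: (b) => /= e1 e2.
      by rewrite e1 in e2 *; last (by lia); rewrite addbF in e2; rewrite -e2 //; lia.
    by rewrite e1 in e2 *; last (by lia); rewrite addFb in e2; rewrite -e2 //; lia.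
  by case=> e4 e5; rewrite -(odd_double_half H); case: (odd H).
have hP : h P.*2 /\ h P.*2.+1.
  have e3 : h P = false by apply: h0; lia.
  have P0 : (0 < P)%N by lia.
  have := hS P P0; have := hb P P0; rewrite e3 eqxx.
  by case: (b) => /= ->; case: (h _).
exists u; split => //.
- by rewrite !uE ?hP.1 ?hP.2 //; lia.
- by move=> H lH; rewrite uE ?h0 //; lia.
- move=> H lH oH nH; rewrite uE; last by lia.
  rewrite -(odd_double_half H) oH hb; last by lia.
  suff -> : (H./2 == P) = false by [].
  by apply/negbTE; apply: contra nH => /eqP <-; rewrite -oH odd_double_half.
Qed.

Lemma hstate_root_flip : exists u : 'rV[bool]_d, hstate u 1 = -1.
Proof.
have [h [h1 hS _]] := heap_parity true true (fun=> false).
have [|u [uE _]] := @hstate_realize h; first by move=> H lH; apply: hS; lia.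
by exists u; rewrite uE ?h1 //; lia.
Qed.


Lemma input_flip (i0 : 'I_d) : i0 \notin js -> exists u : 'rV[bool]_d,
  state u i0 = -1 /\ forall j, (j < N)%N -> j != i0 -> state u j = 1.
Proof.
move=> ni; exists (\row_i (i == i0)); split; first by rewrite state_input mxE eqxx.
move=> j; elim/node_ind => [i|m lm E1 E2 _].
  by rewrite state_input mxE (inj_eq val_inj) => /negPf ->.
have it : nat_of_ord i0 \notin tree_nodes by rewrite (leaf_tree i0).
have ch b : child k js b m != i0.
  apply: contra it => /eqP <-; rewrite /child -/tree_nodes mem_nth // size_tree_nodes.
  by case: b; lia.
by rewrite state_inner // E1 // E2 // mulr1.
Qed.

Lemma hstate_flip1 H : (0 < H < k.*2)%N -> exists u, hstate u H = -1.
Proof.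
move=> lH; have [/eqP ->|H1] := boolP (H == 1%N); first exact: hstate_root_flip.
have [|u [[u0 u1] _ _ _]] := @hstate_flip false H./2; first by lia.
by exists u; rewrite -(odd_double_half H); case: (odd H).
Qed.

(** Flipping H2 together with its sibling works unless H1 is that sibling. In that case the product
    is the state of the parent, which can be flipped by itself. *)
Lemma hstate_flip2 H1 H2 : (0 < H1 < H2)%N -> (H2 < k.*2)%N ->
  exists u, hstate u H1 * hstate u H2 = -1.
Proof.
move=> l12 l2; have [|u [[u0 u1] ul _ _]] := @hstate_flip false H2./2; first by lia.
have [l1|l1] := ltnP H1 (H2./2).*2.
  exists u; rewrite (ul H1) ?mul1r; last by lia.
  by rewrite -(odd_double_half H2); case: (odd H2).
have [|w wE] := @hstate_flip1 H2./2; first by lia.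
exists w; rewrite -wE (hstate_inner _ (H := H2./2)); last by lia.
by congr (hstate w _ * hstate w _); lia.
Qed.

(** As for two nodes; if H1 and H2 are siblings, their product is the state of a parent other than
    M, which leaves two distinct nodes. *)
Lemma hstate_flip3 M H1 H2 : (0 < M < H1)%N -> (H1 < H2 < k.*2)%N ->
  (H1 != M.*2) || (H2 != M.*2.+1) ->
  exists u, hstate u M * (hstate u H1 * hstate u H2) = -1.
Proof.
move=> lM l12 nM; have [|u [[u0 u1] ul _ _]] := @hstate_flip false H2./2; first by lia.
have [l1|l1] := ltnP H1 (H2./2).*2.
  exists u; rewrite (ul M) ?(ul H1) ?mul1r; [|lia|lia].
  by rewrite -(odd_double_half H2); case: (odd H2).
suff [w wE] : exists w, hstate w M * hstate w H2./2 = -1.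
  exists w; rewrite -wE (hstate_inner _ (H := H2./2)); last by lia.
  by congr (_ * (hstate w _ * hstate w _)); lia.
have [ltM|gtM|eqM] := ltngtP M H2./2; last by lia.
  by apply: hstate_flip2; lia.
have [||w wE] := @hstate_flip2 H2./2 M; [lia|lia|].
by exists w; rewrite mulrC.
Qed.

Lemma state_flip1 j : (j < N)%N -> exists u, state u j = -1.
Proof.
move=> jN; have [jt|jt] := boolP (j \in tree_nodes); last first.
  by have [i -> ni] := nontree_input jN jt; have [u [uE _]] := input_flip ni; exists u.
by have [u uE] := hstate_flip1 (hidx_bound jt); exists u; rewrite -(hidxK jt).
Qed.

Lemma state_flip2 a b : (a < N)%N -> (b < N)%N -> a != b ->
  exists u, state u a * state u b = -1.
Proof.
move=> aN bN ab; have [at'|at'] := boolP (a \in tree_nodes); last first.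
  have [i ai ni] := nontree_input aN at'; have [u [uE u1]] := input_flip ni.
  by exists u; rewrite ai uE u1 ?mulr1 // -ai eq_sym.
have [bt|bt] := boolP (b \in tree_nodes); last first.
  have [i bi ni] := nontree_input bN bt; have [u [uE u1]] := input_flip ni.
  by exists u; rewrite bi uE u1 ?mul1r // -bi.
have nab : hidx a != hidx b.
  by apply: contra ab => /eqP E; rewrite -(hidxK at') E hidxK.
have la := hidx_bound at'; have lb := hidx_bound bt.
have [lt|lt|E] := ltngtP (hidx a) (hidx b); last by rewrite E eqxx in nab.
  have [||u uE] := @hstate_flip2 (hidx a) (hidx b); [lia|lia|].
  by exists u; rewrite -uE /hstate !hidxK.
have [||u uE] := @hstate_flip2 (hidx b) (hidx a); [lia|lia|].
by exists u; rewrite -uE /hstate !hidxK // mulrC.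
Qed.

(** This makes E[x_m x_j x_a] vanish for every a < m when j is not a child of m. The case a = j
    reduces to a single flip of x_m. *)
Lemma state_flip3 m j a : (d <= m < N)%N -> (j < m)%N -> (a < m)%N ->
  j != child k js false m -> j != child k js true m ->
  exists u, state u m * state u j * state u a = -1.
Proof.
move=> lm jm am j1 j2; have mN : (m < N)%N by lia.
have jN : (j < N)%N by lia.
have aN : (a < N)%N by lia.
have [/eqP ja|ja] := boolP (j == a).
  have [u uE] := state_flip1 mN; exists u.
  by rewrite -ja -mulrA -expr2 state_sqr // mulr1.
have [at'|at'] := boolP (a \in tree_nodes); last first.
  have [i ai ni] := nontree_input aN at'; have [u [uE u1]] := input_flip ni.
  by exists u; rewrite ai uE !u1 ?mul1r // -ai; lia.
have [jt|jt] := boolP (j \in tree_nodes); last first.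
  have [i ji ni] := nontree_input jN jt; have [u [uE u1]] := input_flip ni.
  by exists u; rewrite ji uE !u1 ?mul1r ?mulr1 // -ji; lia.
have ta := hidx_bound at'; have tj := hidx_bound jt.
have mt := inner_tree lm; have tm := hidx_bound mt.
move: am jm; rewrite !(hidx_lt lm) // => am jm.
have nja : hidx j != hidx a.
  by apply: contra ja => /eqP E; rewrite -(hidxK jt) E hidxK.
have Mk : (0 < hidx m < k)%N by rewrite hidx_inner; lia.
have nc (b : bool) : hidx j != (b + (hidx m).*2)%N.
  have : j != child k js (~~ b) m by case: b.
  by apply: contra => /eqP E; rewrite -(hidxK jt) E hnode_child // hidxK.
have [lt|lt|E] := ltngtP (hidx j) (hidx a); last by rewrite E eqxx in nja.
  have [|||u uE] := @hstate_flip3 (hidx m) (hidx j) (hidx a); [lia|lia| |].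
    by rewrite (nc false).
  by exists u; rewrite -uE /hstate !hidxK // mulrA.
have [|||u uE] := @hstate_flip3 (hidx m) (hidx a) (hidx j); [lia|lia| |].
  by rewrite (nc true) orbT.
by exists u; rewrite -uE /hstate !hidxK // -mulrA [state u j * _]mulrC.
Qed.

(* The vector of [hstate_flip b] flips two siblings and, below them, only nodes not
   on side b; hence the nodes on one side are mutually independent signs. *)
Definition side (j : nat) : bool := (j \in tree_nodes) && odd (hidx j).

(** The bound excludes the root, which has no parent to feed to [hstate_flip]. Prefix sums over j <
    m with m < N never contain it. *)
Lemma state_flip_side j : (j < N.-1)%N -> exists u, state u j = -1 /\
  forall a, (a < N.-1)%N -> a != j -> side a = side j -> state u a = 1.
Proof.
move=> jN1; have jN : (j < N)%N by lia.
have [jt|jt] := boolP (j \in tree_nodes); last first.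
  have [i ji ni] := nontree_input jN jt; have [u [uE u1]] := input_flip ni.
  exists u; rewrite ji uE; split => // a aN aj _.
  by apply: u1 => //; lia.
have tree_gt1 a : a \in tree_nodes -> (a < N.-1)%N -> (1 < hidx a)%N.
  have lN : (d <= N.-1 < N)%N by lia.
  by move=> ta; rewrite (hidx_lt lN ta) hidx_inner //; lia.
have tj := hidx_bound jt; have j2 := tree_gt1 _ jt jN1.
have [|u [[u0 u1] _ us uj]] := @hstate_flip (odd (hidx j)) (hidx j)./2; first by lia.
exists u; split.
  by rewrite -(hidxK jt) -[state _ _]/(hstate u (hidx j)) -(odd_double_half (hidx j));
    case: (odd _).
move=> a aN aj; rewrite /side jt /=; have [ta|ta _] := boolP (a \in tree_nodes) => /=.
  move=> sa; rewrite -(hidxK ta) -[state _ _]/(hstate u (hidx a)).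
  have := hidx_bound ta; have := tree_gt1 _ ta aN => l1 l2.
  apply: us => //; first by lia.
  rewrite odd_double_half; apply: contra aj => /eqP E.
  by rewrite -(hidxK ta) E hidxK.
have [|i ai ni] := nontree_input _ ta; first by lia.
by rewrite ai state_input uj.
Qed.

(** [heap_swap] is realised by a permutation [s] of the leaf inputs. As k is a power of 2, the
    leaves form a full level and are mapped to leaves. *)
Lemma state_swap v m : k = (2 ^ v)%N -> (d <= m < N)%N ->
  exists (s : 'rV[bool]_d -> 'rV[bool]_d) (r : nat -> nat),
  [/\ involutive s,
      forall y j, (j < N)%N -> state (s y) j = state y (r j),
      forall j, (j < m)%N -> (r j < m)%N /\ r (r j) = j,
      r m = m & r (child k js false m) = child k js true m].
Proof.
move=> kv lm; have mt := inner_tree lm; have tm := hidx_bound mt.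
have Mk : (0 < hidx m < k)%N by rewrite hidx_inner; lia.
have [|f [fK fe fc fl [fM fM1]]] := @heap_swap (hidx m); first by lia.
have [j0 _] := j0P.
have f0 H : (0 < H)%N -> (0 < f H)%N by move=> H0; have := fe 0%N H H0; rewrite expn0 H0.
have fk H : (0 < H)%N -> (k <= f H)%N = (k <= H)%N by rewrite kv; apply: fe.
have f2k H : (0 < H)%N -> (k.*2 <= f H)%N = (k.*2 <= H)%N.
  by rewrite kv -mul2n -expnS; apply: fe.
pose lf H := nth j0 js (k.*2.-1 - H).
have lfm H : (k <= H < k.*2)%N -> lf H \in js.
  by move=> lH; rewrite mem_nth // sjs; lia.
have lfK H : (k <= H < k.*2)%N -> (k.*2.-1 - index (lf H) js)%N = H.
  by move=> lH; rewrite index_uniq // ?sjs; lia.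
pose s (y : 'rV[bool]_d) : 'rV[bool]_d := \row_i
  (if i \in js then y ord0 (lf (f (k.*2.-1 - index i js)%N)) else y ord0 i).
have leafE i : i \in js -> exists2 H, (k <= H < k.*2)%N & i = lf H.
  move=> ij; exists (k.*2.-1 - index i js)%N; first by have := ij; rewrite -index_mem sjs; lia.
  by rewrite /lf subKn ?nth_index //; have := ij; rewrite -index_mem sjs; lia.
have fleaf H : (k <= H < k.*2)%N -> (k <= f H < k.*2)%N.
  by move=> lH; have := fk H; have := f2k H; lia.
have sleaf y H : (k <= H < k.*2)%N -> s y ord0 (lf H) = y ord0 (lf (f H)).
  by move=> lH; rewrite mxE lfm // lfK.
have hs y : forall H, (0 < H < k.*2)%N -> hstate (s y) H = hstate y (f H).
  apply: heap_up_ind => [H lH|H lH E1 E2].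
    by rewrite /hstate !(hnode_leaf j0) ?fleaf // !state_input -!/(lf _) sleaf.
  have lf' : (0 < f H < k)%N by have := fk H; have := f0 H; lia.
  rewrite (hstate_inner _ lH) E1 E2 (hstate_inner _ lf').
  have [/eqP ->|HM] := boolP (H == hidx m).
    by rewrite fM fM1 (fl (hidx m)) 1?mulrC //; lia.
  by have [|-> ->] := fc H _ HM; first by lia.
pose r j := if j \in tree_nodes then hnode (f (hidx j)) else j.
have ft j : j \in tree_nodes -> (0 < f (hidx j) < k.*2)%N.
  by move=> /hidx_bound lj; have := f2k (hidx j); have := f0 (hidx j); lia.
exists s, r; split.
- move=> y; apply/rowP => i; have [ij|ij] := boolP (i \in js).
    have [H lH ->] := leafE _ ij; rewrite sleaf // sleaf ?fleaf //.
    by have [|-> _] := fK H; first by lia.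
  by rewrite !mxE (negPf ij).
- move=> y j jN; rewrite /r; have [jt|jt] := boolP (j \in tree_nodes).
    by rewrite -[in LHS](hidxK jt) -[LHS]/(hstate (s y) (hidx j)) hs ?hidx_bound.
  have [i ji ij] := nontree_input jN jt.
  by rewrite ji !state_input mxE (negPf ij).
- move=> j jm; rewrite /r; have [jt|/negPf jt] := boolP (j \in tree_nodes); last by rewrite jt.
  have lj := hidx_bound jt; have [|fj1 fj2] := fK (hidx j); first by lia.
  rewrite hnode_tree ?ft // hnodeK ?ft // fj1 hidxK // (hidx_lt lm) ?hnode_tree ?ft //.
  by rewrite hnodeK ?ft // fj2 -(hidx_lt lm).
- by rewrite /r mt fl ?hidxK //; lia.
have cE b : child k js b m = hnode (~~ b + (hidx m).*2)%N.
  by rewrite hnode_child // negbK hidxK.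
rewrite !cE /r hnode_tree ?hnodeK /=; [by rewrite fM1|lia|lia].
Qed.

Lemma state_root (p : {set 'I_d}) y : perm_eq js (enum p) ->
  state y N.-1 = \prod_(j in p) sgn R (y ord0 j).
Proof.
move=> jp; have [j0 _] := j0P.
(* Passing from n to n + 1 replaces the factor of node n by those of its children 2n and 2n + 1; at
   n = k exactly the leaves remain. *)
have step n : (0 < n <= k)%N -> hstate y 1 = \prod_(n <= H < n.*2) hstate y H.
  elim: n => // n IH ln; have [/eqP ->|n0] := boolP (n == 0%N).
    by rewrite big_nat1.
  rewrite IH; last by lia.
  rewrite big_ltn; last by lia.
  rewrite doubleS 2?big_nat_recr /=; [|lia|lia].
  rewrite (hstate_inner _ (H := n)); last by lia.
  by rewrite mulrC mulrA.
have -> : N.-1 = hnode 1 by rewrite hnode_inner; lia.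
rewrite -[LHS]/(hstate y 1) (step k); last by lia.
rewrite -big_enum /= -(perm_big _ jp) /= (big_nth j0) sjs big_nat_rev /=.
rewrite -{1}[k]add0n -addnn big_addn addnK big_nat [RHS]big_nat; apply: eq_bigr => i li.
rewrite /hstate (hnode_leaf j0); last by lia.
rewrite state_input; congr (sgn R (y _ (nth _ _ _))); lia.
Qed.

End ParityTree.

(** * Expectations under uniform inputs *)

Definition mean (R : realType) (T : finType) (f : T -> R) : R :=
  (\sum_x f x) / #|T|%:R.

Section Mean.
Variables (R : realType) (T : finType).
Implicit Types f g : T -> R.

Lemma eq_mean f g : f =1 g -> mean f = mean g.
Proof. by move=> fg; congr (_ / _); apply: eq_bigr. Qed.

Lemma meanD f g : mean (fun x => f x + g x) = mean f + mean g.
Proof. by rewrite /mean big_split mulrDl. Qed.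

Lemma meanZ a f : mean (fun x => a * f x) = a * mean f.
Proof. by rewrite /mean -mulr_sumr mulrA. Qed.

Lemma meanN f : mean (fun x => - f x) = - mean f.
Proof. by rewrite /mean sumrN mulNr. Qed.

Lemma meanB f g : mean (fun x => f x - g x) = mean f - mean g.
Proof. by rewrite meanD meanN. Qed.

Lemma mean_sum (I : Type) (s : seq I) (P : pred I) (F : I -> T -> R) :
  mean (fun x => \sum_(i <- s | P i) F i x) = \sum_(i <- s | P i) mean (F i).
Proof. by rewrite /mean exchange_big mulr_suml. Qed.

Lemma le_mean f g : (forall x, f x <= g x) -> mean f <= mean g.
Proof. by move=> fg; rewrite ler_wpM2r ?invr_ge0 // ler_sum. Qed.

Lemma mean_reindex (s : T -> T) f : injective s -> mean (f \o s) = mean f.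
Proof. by move=> si; rewrite /mean [in RHS](reindex_inj si). Qed.

Lemma mean_odd (s : T -> T) f : injective s -> (forall x, f (s x) = - f x) -> mean f = 0.
Proof.
move=> si fs; have := mean_reindex f si.
by rewrite (@eq_mean _ (fun x => - f x)) ?meanN //; lra.
Qed.

Hypothesis T0 : (0 < #|T|)%N.

Lemma mean_cst (a : R) : mean (fun _ : T => a) = a.
Proof. by rewrite /mean sumr_const -[a *+ _]mulr_natr mulfK // pnatr_eq0 -lt0n. Qed.

Lemma ler_norm_mean f : `|mean f| <= mean (fun x => `|f x|).
Proof.
rewrite /mean normrM normfV normr_nat ler_wpM2r ?invr_ge0 //; exact: ler_norm_sum.
Qed.

(* The hypothesis provides, for every index, a measure-preserving map that flips
   this sign only, so that all odd mixed moments vanish. *)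
Lemma sign_sum_moments (I : eqType) (x : I -> T -> R) (s : seq I) : uniq s ->
  (forall i, i \in s -> forall y, x i y ^+ 2 = 1) ->
  (forall i, i \in s -> exists2 t : T -> T, injective t &
     (forall y, x i (t y) = - x i y) /\
     forall j, j \in s -> j != i -> forall y, x j (t y) = x j y) ->
  mean (fun y => (\sum_(i <- s) x i y) ^+ 2) = (size s)%:R /\
  mean (fun y => (\sum_(i <- s) x i y) ^+ 4) <= 3 * (size s)%:R ^+ 2.
Proof.
elim: s => [|i s IH] /=.
  move=> _ _ _; under eq_mean do rewrite big_nil expr0n /=.
  under [X in _ /\ X <= _]eq_mean do rewrite big_nil expr0n /=.
  by rewrite !mean_cst expr0n mulr0.
case/andP => nis us x2 xt.
have [||m2 m4] := IH us; first by move=> j js; apply: x2; rewrite inE js orbT.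
  move=> j js; have [|t ti [t1 t2]] := xt j; first by rewrite inE js orbT.
  by exists t => //; split=> // l ls; apply: t2; rewrite inE ls orbT.
have [|t ti [t1 t2]] := xt i; first by rewrite inE eqxx.
have tB y : \sum_(j <- s) x j (t y) = \sum_(j <- s) x j y.
  rewrite big_seq [RHS]big_seq; apply: eq_bigr => j js; apply: t2.
    by rewrite inE js orbT.
  by apply: contraNneq nis => <-.
have x21 : forall y, x i y ^+ 2 = 1 by apply: x2; rewrite inE eqxx.
pose B y := \sum_(j <- s) x j y.
have o1 : mean (fun y => x i y * B y) = 0.
  by apply: (mean_odd ti) => y; rewrite /B t1 tB mulNr.
have o3 : mean (fun y => x i y * B y ^+ 3) = 0.
  by apply: (mean_odd ti) => y; rewrite /B t1 tB mulNr.
split.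
  rewrite (@eq_mean _ (fun y => 1 + (2 * (x i y * B y) + B y ^+ 2))).
    by rewrite meanD meanD meanZ mean_cst o1 m2 mulr0 add0r -natr1 addrC.
  by move=> y; rewrite big_cons -/(B y) sqrrD x21 -mulr_natl addrA.
rewrite (@eq_mean _ (fun y => 1 + (4 * (x i y * B y) +
  (6 * B y ^+ 2 + (4 * (x i y * B y ^+ 3) + B y ^+ 4))))).
  rewrite !meanD !meanZ mean_cst o1 o3 m2 -natr1.
  (* The induction closes because 1 + 6u + 3u^2 <= 3 (u + 1)^2. *)
  by move: m4; rewrite -/B; set u := (size s)%:R; nra.
move=> y; rewrite big_cons -/(B y).
have -> : (x i y + B y) ^+ 4 = x i y ^+ 2 * x i y ^+ 2 + (4 * (x i y ^+ 2 * x i y * B y) +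
  (6 * (x i y ^+ 2 * B y ^+ 2) + (4 * (x i y * B y ^+ 3) + B y ^+ 4))) by ring.
by rewrite !x21 !mul1r.
Qed.

End Mean.

(** * Moments of prefix sums and the gap in the expected gradient *)

Section Population.
Variables (R : realType) (d k : nat) (js : seq 'I_d).
Hypotheses (sjs : size js = k) (ujs : uniq js) (k2 : (2 <= k)%N).

Local Notation N := (d + k.-1)%N.
Local Notation S := (@state R d k js).

Definition prefix_sum (m : nat) (y : 'rV[bool]_d) : R := \sum_(0 <= j < m) S y j.

Definition prefix_avg (m : nat) (y : 'rV[bool]_d) : R := prefix_sum m y / m%:R.

Lemma card_bits_gt0 : (0 < #|{: 'rV[bool]_d}|)%N.
Proof. by apply/card_gt0P; exists 0. Qed.

Lemma xorv_inj (u : 'rV[bool]_d) : injective (fun y => xorv y u).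
Proof. by apply: inv_inj => y; exact: xorvK. Qed.

Lemma state_norm y j : (j < N)%N -> `|S y j| = 1.
Proof. by move=> jN; apply/eqP; rewrite -sqrp_eq1 // -normrX (state_sqr R sjs ujs k2) ?normr1. Qed.

Lemma prefix_avg_norm m y : (0 < m <= N)%N -> `|prefix_avg m y| <= 1.
Proof.
move=> lm; rewrite /prefix_avg normrM normfV normr_nat ler_pdivrMr ?ltr0n; last by lia.
rewrite mul1r; apply: (le_trans (ler_norm_sum _ _ _)).
rewrite (@eq_big_nat _ _ _ _ _ _ (fun=> 1)); last by move=> j lj; rewrite state_norm //; lia.
by rewrite sumr_const_nat subn0.
Qed.

Lemma mean_state2 a b : (a < N)%N -> (b < N)%N -> mean (fun y => S y a * S y b) = (a == b)%:R.
Proof.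
move=> aN bN; case: eqP => [<-|/eqP ab].
  under eq_mean do rewrite -expr2 (state_sqr R sjs ujs k2) //.
  by rewrite mean_cst ?card_bits_gt0.
have [u uE] := state_flip2 R sjs ujs k2 aN bN ab.
apply: (mean_odd (@xorv_inj u)) => y.
by rewrite !(stateM R sjs ujs k2) // mulrACA uE mulrN1.
Qed.

Lemma mean_state_prefix m j : (m <= N)%N -> (j < m)%N ->
  mean (fun y => S y j * prefix_sum m y) = 1.
Proof.
move=> mN jm; under eq_mean do rewrite /prefix_sum mulr_sumr.
rewrite mean_sum big_nat (eq_bigr (fun a => (j == a)%:R)); last first.
  by move=> a la; rewrite mean_state2 //; lia.
rewrite -big_nat big_mkord (bigD1 (Ordinal jm)) //= eqxx big1 ?addr0 // => i.
by rewrite -val_eqE /= eq_sym => /negPf ->.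
Qed.

(** The target bit times one child is the other child, so this is the mean of [mean_state_prefix] at
    the sibling. *)
Lemma mean_parent_child_prefix m b : (d <= m < N)%N ->
  mean (fun y => S y m * S y (child k js b m) * prefix_sum m y) = 1.
Proof.
move=> lm; rewrite -(@mean_state_prefix m (child k js (~~ b) m)) ?child_lt //; last by lia.
have cN b' : (child k js b' m < N)%N by have := child_lt sjs ujs k2 b' lm; lia.
apply: eq_mean => y; congr (_ * _); rewrite (state_inner R sjs ujs k2) //.
case: b => /=; first by rewrite -mulrA -expr2 (state_sqr R sjs ujs k2) ?mulr1.
by rewrite mulrAC -expr2 (state_sqr R sjs ujs k2) ?mul1r.
Qed.

Lemma mean_parent_nonchild_prefix m j : (d <= m < N)%N -> (j < m)%N ->
  j != child k js false m -> j != child k js true m ->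
  mean (fun y => S y m * S y j * prefix_sum m y) = 0.
Proof.
move=> lm jm j1 j2; under eq_mean do rewrite /prefix_sum mulr_sumr.
rewrite mean_sum big_nat big1 // => a la.
have [u uE] := state_flip3 R sjs ujs k2 lm jm (a := a) la j1 j2.
apply: (mean_odd (@xorv_inj u)) => y.
rewrite !(stateM R sjs ujs k2); [|lia|lia|lia].
rewrite -[RHS]mulrN1 -uE; ring.
Qed.

(** Split the sum by [side] into p + q. Each part consists of at most m signs with individual flips
    and has fourth moment at most 3m^2, and (p + q)^4 <= 8 (p^4 + q^4), whence 48 = 8 (3 + 3). *)
Lemma mean_prefix_pow4 m : (m < N)%N -> mean (fun y => prefix_sum m y ^+ 4) <= 48 * m%:R ^+ 2.
Proof.
move=> mN; pose s (b : bool) := [seq j <- index_iota 0 m | side k js j == b].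
have mem_s b j : j \in s b -> (j < m)%N /\ side k js j = b.
  by rewrite mem_filter mem_index_iota => /andP[/eqP ->]; split.
have sz b : (size (s b) <= m)%N.
  by rewrite size_filter (leq_trans (count_size _ _)) // size_iota; lia.
have m4 b : mean (fun y => (\sum_(j <- s b) S y j) ^+ 4) <= 3 * m%:R ^+ 2.
  have [|||_ le4] := @sign_sum_moments R _ card_bits_gt0 _ (fun j y => S y j) (s b).
  - by rewrite filter_uniq ?iota_uniq.
  - by move=> j /mem_s[jm _] y; rewrite (state_sqr R sjs ujs k2) //; lia.
  - move=> j /mem_s[jm jb]; have [|u [u1 u2]] := state_flip_side R sjs ujs k2 (j := j).
      by lia.
    exists (fun y => xorv y u); first exact: xorv_inj.
    split=> [y|a /mem_s[am ab] aj y]; first by rewrite (stateM R sjs ujs k2) ?u1 ?mulrN1 //; lia.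
    rewrite (stateM R sjs ujs k2) ?u2 ?mulr1 ?jb //; lia.
  apply: (le_trans le4); rewrite ler_wpM2l // lerXn2r ?nnegrE ?ler0n // ler_nat //.
have -> : 48 * m%:R ^+ 2 = 8 * (3 * m%:R ^+ 2 + 3 * m%:R ^+ 2) :> R by ring.
apply: (@le_trans _ _ (mean (fun y => 8 * ((\sum_(j <- s true) S y j) ^+ 4 +
   (\sum_(j <- s false) S y j) ^+ 4)))); last first.
  by rewrite meanZ meanD ler_wpM2l // lerD.
apply: le_mean => y; rewrite /prefix_sum (bigID (side k js)) /=.
rewrite -big_filter -[X in (_ + X) ^+ 4]big_filter.
have -> : [seq i <- index_iota 0 m | side k js i] = s true.
  by apply: eq_filter => j; rewrite eqb_id.
have -> : [seq i <- index_iota 0 m | ~~ side k js i] = s false.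
  by apply: eq_filter => j; rewrite eqbF_neg.
set p := \sum_(i <- _) _; set q := \sum_(i <- _) _.
have : 0 <= (p - q) ^+ 2 * (7 * p ^+ 2 + 10 * p * q + 7 * q ^+ 2).
  rewrite mulr_ge0 ?sqr_ge0 // (_ : _ + _ = 5 * (p + q) ^+ 2 + 2 * p ^+ 2 + 2 * q ^+ 2).
    by rewrite !addr_ge0 // mulr_ge0 ?sqr_ge0.
  by ring.
have -> : 8 * (p ^+ 4 + q ^+ 4) = (p + q) ^+ 4 +
  (p - q) ^+ 2 * (7 * p ^+ 2 + 10 * p * q + 7 * q ^+ 2) by ring.
by rewrite lerDl.
Qed.

(* |z|^3 <= m^(-3/2) + m^(1/2) z^4 turns the fourth moment into a third one. *)
Lemma mean_prefix_norm3 m : (0 < m < N)%N ->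
  mean (fun y => `|prefix_avg m y| ^+ 3) <= 49 / (m%:R * Num.sqrt m%:R).
Proof.
move=> lm; have m0 : 0 < m%:R :> R by rewrite ltr0n; lia.
set s := Num.sqrt m%:R; have s0 : 0 < s by rewrite sqrtr_gt0.
have s2 : m%:R = s ^+ 2 :> R by rewrite sqr_sqrtr // ltW.
apply: (@le_trans _ _ (mean (fun y => (m%:R * s)^-1 + s / m%:R ^+ 4 * prefix_sum m y ^+ 4))).
  apply: le_mean => y; rewrite /prefix_avg normrM normfV normr_nat.
  set Z := prefix_sum m y; rewrite -(ger0_norm (x := Z ^+ 4)) ?exprn_even_ge0 // normrX.
  have := normr_ge0 Z; set w := `|Z| => w0.
  rewrite s2.
  have -> : (w / s ^+ 2) ^+ 3 = (w / s) ^+ 3 / s ^+ 3 by field; rewrite gt_eqF.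
  have -> : (s ^+ 2 * s)^-1 + s / (s ^+ 2) ^+ 4 * w ^+ 4 = (1 + (w / s) ^+ 4) / s ^+ 3.
    by field; rewrite gt_eqF.
  rewrite ler_wpM2r ?invr_ge0 ?exprn_ge0 ?(ltW s0) //.
  have : 0 <= w / s by rewrite divr_ge0 // ltW.
  move: (w / s) => t t0; have [t1|t1] := leP t 1.
    have : t ^+ 3 <= 1 by rewrite exprn_ile1.
    by have := exprn_ge0 4 t0; lra.
  have : t ^+ 3 * 1 <= t ^+ 3 * t by rewrite ler_wpM2l ?exprn_ge0 // ltW.
  by rewrite mulr1 -exprSr; lra.
rewrite meanD mean_cst ?card_bits_gt0 // meanZ.
have mN : (m < N)%N by lia.
have := mean_prefix_pow4 mN; set e := mean _ => e4.
have : s / m%:R ^+ 4 * e <= s / m%:R ^+ 4 * (48 * m%:R ^+ 2).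
  by rewrite ler_wpM2l // divr_ge0 ?exprn_ge0 // ltW.
have -> : s / m%:R ^+ 4 * (48 * m%:R ^+ 2) = 48 / (m%:R * s).
  by rewrite s2; field; rewrite gt_eqF.
lra.
Qed.


(** By [grad_loss0], 1/m times the sample average of this quantity is the (j, m) entry of the
    gradient at the origin. *)
Definition grad_sample (phi dphi : R -> R) (m j : nat) (y : 'rV[bool]_d) : R :=
  (phi (prefix_avg m y) - S y m) * dphi (prefix_avg m y) * (S y j - prefix_avg m y).

(* Exchanging the subtrees below the two children of m fixes the prefix sum and
   the target bit. *)
Lemma mean_grad_sample_children v phi dphi m : k = (2 ^ v)%N -> (d <= m < N)%N ->
  mean (grad_sample phi dphi m (child k js false m)) =
  mean (grad_sample phi dphi m (child k js true m)).
Proof.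
move=> kv lm; have [s [r [sK sE rK rm rc]]] := state_swap R sjs ujs k2 kv lm.
have cm := child_lt sjs ujs k2 false lm.
rewrite -[RHS](mean_reindex _ (inv_inj sK)) -[LHS](mean_reindex _ (inv_inj sK)).
rewrite -[RHS](mean_reindex _ (inv_inj sK)).
have cm' := child_lt sjs ujs k2 true lm.
have pE y : prefix_avg m (s y) = prefix_avg m y.
  congr (_ / _); rewrite /prefix_sum.
  rewrite (@eq_big_nat _ _ _ _ _ _ (fun j => S y (r j))); last first.
    by move=> j lj; rewrite sE //; lia.
  rewrite !big_mkord.
  have rlt (j : 'I_m) : (r j < m)%N by have [] := rK j (ltn_ord j).
  rewrite [RHS](reindex_inj (h := fun j => Ordinal (rlt j))) //.
  move=> i j /(congr1 val) /= E; apply: val_inj; rewrite /=.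
  by rewrite -(rK i (ltn_ord i)).2 E (rK j (ltn_ord j)).2.
apply: eq_mean => y; rewrite /= /grad_sample sK pE.
have mN : (m < N)%N by lia.
have cN : (child k js false m < N)%N by lia.
by rewrite !sE // rm rc.
Qed.

(** The leading part of the difference has mean -(2c/m) ((1 - 1) + (0 - 1)) = 2c/m. The cubic
    remainder 2L |z|^3 is averaged by [mean_prefix_norm3], and 98 = 2 * 49. *)
Lemma grad_sample_gap (phi dphi : R -> R) (c K : R) m j b : 0 < c ->
  (forall t, `|t| <= 1 -> `|phi t - (-1 + c * t ^+ 2)| <= K * `|t| ^+ 4) ->
  (forall t, `|t| <= 1 -> `|dphi t - 2 * c * t| <= K * `|t| ^+ 3) ->
  (d <= m < N)%N -> (j < m)%N ->
  j != child k js false m -> j != child k js true m ->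
  (2 * c - 98 * (K ^+ 2 + 3 * c * K + 2 * c ^+ 2 + 2 * K) / Num.sqrt m%:R) / m%:R <=
  mean (grad_sample phi dphi m j) - mean (grad_sample phi dphi m (child k js b m)).
Proof.
move=> c0 phiE dphiE lm jm j1 j2; set L := _ + 2 * K.
have m0 : 0 < m%:R :> R by rewrite ltr0n; lia.
set q := child k js b m; have qm : (q < m)%N by apply: child_lt.
have mN : (m < N)%N by lia.
have K0 : 0 <= K.
  have := phiE 1; rewrite normr1 lexx !expr1n !mulr1 => /(_ isT).
  exact: le_trans (normr_ge0 _).
have L0 : 0 <= L by rewrite /L !addr_ge0 ?mulr_ge0 ?exprn_ge0 // ltW.
have point y : - (2 * c / m%:R) * ((S y j * prefix_sum m y - S y q * prefix_sum m y) +
    (S y m * S y j * prefix_sum m y - S y m * S y q * prefix_sum m y)) -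
    2 * L * `|prefix_avg m y| ^+ 3 <= grad_sample phi dphi m j y - grad_sample phi dphi m q y.
  have z1 : `|prefix_avg m y| <= 1 by apply: prefix_avg_norm; lia.
  have -> : prefix_sum m y = m%:R * prefix_avg m y by rewrite mulrC divfK // gt_eqF.
  rewrite /grad_sample; set z := prefix_avg m y in z1 *.
  have [e1 e2] := (phiE z z1, dphiE z z1).
  have := state_norm y mN; have := state_norm (j := j) y; have := state_norm (j := q) y.
  move=> /(_ ltac:(lia)); move: (S y m) (S y j) (S y q) => x a a' a'1 /(_ ltac:(lia)) a1 x1.
  (* [r] is the error of replacing (phi z - x) phi'(z) by -2c (1 + x) z. It splits into five terms
     with coefficients K^2, 2cK, cK, 2c^2 and 2K, whose sum is [L]. *)
  pose r := (phi z - x) * dphi z + 2 * c * (1 + x) * z.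
  have rE : `|r| <= L * `|z| ^+ 3.
    pose P := phi z - (-1 + c * z ^+ 2); pose D := dphi z - 2 * c * z.
    have -> : r = P * D + 2 * c * (P * z) + c * (z ^+ 2 * D) + 2 * c ^+ 2 * z ^+ 3 - (1 + x) * D.
      by rewrite /r /P /D; ring.
    move: e1 e2; rewrite -/P -/D; move: P D => P D e1 e2.
    have w0 := normr_ge0 z; have x2 : `|1 + x| <= 2.
      by rewrite (le_trans (ler_normD _ _)) // normr1 x1.
    have w3 n : `|z| ^+ (3 + n) <= `|z| ^+ 3 by rewrite ler_wiXn2l // leq_addr.
    have b1 : `|P * D| <= K ^+ 2 * `|z| ^+ 3.
      rewrite normrM (le_trans (ler_pM _ _ e1 e2)) // mulrACA -expr2 -exprD.
      by rewrite ler_wpM2l ?exprn_ge0 // (w3 4).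
    have b2 : `|2 * c * (P * z)| <= 2 * c * K * `|z| ^+ 3.
      rewrite normrM gtr0_norm ?mulr_gt0 // -!mulrA !ler_wpM2l ?(ltW c0) // normrM.
      by rewrite (le_trans (ler_wpM2r w0 e1)) // -mulrA -exprSr ler_wpM2l // (w3 2).
    have b3 : `|c * (z ^+ 2 * D)| <= c * K * `|z| ^+ 3.
      rewrite normrM gtr0_norm // -mulrA ler_wpM2l ?(ltW c0) // normrM normrX.
      rewrite (le_trans (ler_wpM2l (exprn_ge0 2 w0) e2)) // mulrCA -exprD ler_wpM2l //.
      exact: (w3 2).
    have b4 : `|2 * c ^+ 2 * z ^+ 3| <= 2 * c ^+ 2 * `|z| ^+ 3.
      by rewrite normrM normrX ger0_norm // mulr_ge0 // sqr_ge0.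
    have b5 : `|(1 + x) * D| <= 2 * K * `|z| ^+ 3.
      by rewrite normrM -mulrA ler_pM.
    have -> : L * `|z| ^+ 3 = K ^+ 2 * `|z| ^+ 3 + 2 * c * K * `|z| ^+ 3 + c * K * `|z| ^+ 3
      + 2 * c ^+ 2 * `|z| ^+ 3 + 2 * K * `|z| ^+ 3 by rewrite /L; ring.
    rewrite (le_trans (ler_normB _ _)) // lerD // (le_trans (ler_normD _ _)) // lerD //.
    rewrite (le_trans (ler_normD _ _)) // lerD // (le_trans (ler_normD _ _)) // lerD //.
  have aa : `|a - a'| <= 2 by rewrite (le_trans (ler_normB _ _)) // a1 a'1.
  have : `|r * (a - a')| <= L * `|z| ^+ 3 * 2 by rewrite normrM ler_pM.
  rewrite ler_norml => /andP[lo _].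
  have -> : (phi z - x) * dphi z * (a - z) - (phi z - x) * dphi z * (a' - z) =
    r * (a - a') - 2 * c * (1 + x) * z * (a - a') by rewrite /r; ring.
  have -> : - (2 * c / m%:R) * (a * (m%:R * z) - a' * (m%:R * z) +
     (x * a * (m%:R * z) - x * a' * (m%:R * z))) = - (2 * c * (1 + x) * z * (a - a')).
    by field; rewrite gt_eqF.
  lra.
rewrite -meanB; apply: le_trans (le_mean point).
pose f i y := S y i * prefix_sum m y; pose h i y := S y m * S y i * prefix_sum m y.
rewrite (meanB (fun y => _ * ((f j y - f q y) + (h j y - h q y)))) !meanZ.
rewrite (meanD (fun y => f j y - f q y)) (meanB (f j)) (meanB (h j)).
rewrite !mean_state_prefix ?(ltnW mN) //.
rewrite mean_parent_nonchild_prefix // mean_parent_child_prefix //.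
have m0' : (0 < m < N)%N by lia.
have := mean_prefix_norm3 m0'; set e3 := mean _ => e3P.
have : 2 * L * e3 <= 2 * L * (49 / (m%:R * Num.sqrt m%:R)) by rewrite ler_wpM2l ?mulr_ge0.
rewrite (_ : (2 * c - _) / _ = 2 * c / m%:R - 2 * L * (49 / (m%:R * Num.sqrt m%:R))).
  by lra.
by field; rewrite !gt_eqF ?sqrtr_gt0.
Qed.

End Population.

(** * The link function and the gradient at the origin *)

Section Link.
Local Open Scope classical_set_scope.
Local Open Scope ring_scope.
Variables (R : realType) (phi dphi : R -> R) (c : R).
Hypothesis L : link_function phi dphi c.

Lemma norm_le1_itv (t : R) : `|t| <= 1 -> t \in `[-1, 1].
Proof. by rewrite ler_norml in_itv. Qed.

Lemma link_bounds : exists K : R, [/\ 1 <= K,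
  forall t : R, `|t| <= 1 -> `|phi t - (-1 + c * t ^+ 2)| <= K * `|t| ^+ 4,
  forall t : R, `|t| <= 1 -> `|dphi t - 2 * c * t| <= K * `|t| ^+ 3 &
  forall s t : R, `|s| <= 1 -> `|t| <= 1 -> `|dphi s - dphi t| <= K * `|s - t|].
Proof.
have [K1 k1] := link_dlip L; have [K2 k2] := link_expand L; have [K3 k3] := link_dexpand L.
exists (1 + `|K1| + `|K2| + `|K3|).
have n1 := normr_ge0 K1; have n2 := normr_ge0 K2; have n3 := normr_ge0 K3.
have l1 := ler_norm K1; have l2 := ler_norm K2; have l3 := ler_norm K3.
split; first by lra.
- move=> t /norm_le1_itv/k2 h; apply: (le_trans h); rewrite ler_wpM2r ?exprn_ge0 //; lra.
- move=> t /norm_le1_itv/k3 h; apply: (le_trans h); rewrite ler_wpM2r ?exprn_ge0 //; lra.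
- move=> s t /norm_le1_itv hs /norm_le1_itv ht; apply: (le_trans (k1 _ _ hs ht)).
  by rewrite ler_wpM2r //; lra.
Qed.

Lemma link_norm t : `|t| <= 1 -> `|phi t| <= 1.
Proof. by move=> /norm_le1_itv/(link_range L); rewrite in_itv /= -ler_norml. Qed.

(* The link function is only differentiable inside [-1, 1], so the inner function
   is required to stay there. *)
Lemma is_derive_link_comp (s : R -> R) (a ds : R) : (forall h, `|s h| <= 1) ->
  is_derive a 1 s ds -> is_derive a 1 (phi \o s) (dphi (s a) * ds).
Proof.
move=> s1 sd.
(* Carathéodory's form of the chain rule: filling in the difference quotient at [s a] makes the
   factorisation valid even where [s] returns to the value [s a]. *)
pose Q u := if u == s a then dphi (s a) else (phi u - phi (s a)) / (u - s a).
have QE h : h^-1 *: ((phi \o s \o shift a) (h *: 1) - (phi \o s) a) =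
    Q (s (h *: 1 + a)) * (h^-1 *: ((s \o shift a) (h *: 1) - s a)).
  rewrite /Q /=; case: eqP => [->|/eqP e]; first by rewrite !subrr !scaler0 mulr0.
  by rewrite -scalerAr divfK // subr_eq0.
have sc : (s \o shift a) (h *: 1) @[h --> 0^'] --> s a.
  have : {for a, continuous s}.
    apply: differentiable_continuous; apply/derivable1_diffP.
    exact: (@ex_derive _ _ _ _ _ _ _ sd).
  move=> sc; apply: (@cvg_comp _ _ _ (fun h : R => h *: 1 + a) s _ (nbhs a)) => //.
  apply: cvg_within_filter.
  have : {for 0, continuous (fun h : R => h *: 1 + a : R)}.
    by apply: cvgD; [apply: cvgZl; exact: cvg_id|exact: cvg_cst].
  by move=> hc U nU; apply: hc; rewrite /= scale0r add0r.
have Qc : Q (s (h *: 1 + a)) @[h --> 0^'] --> dphi (s a).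
  apply/cvgrPdist_lt => e e0.
  have := link_deriv L (norm_le1_itv (s1 a)).
  move=> /cvgrPdist_lt /(_ e e0); rewrite near_withinE.
  move=> /sc; rewrite /nbhs /= => near1.
  apply: filterS near1 => h /=.
  rewrite /Q; case: eqP => [_ _|/eqP ne]; first by rewrite subrr normr0.
  apply => //; exact: norm_le1_itv.
have dc := @ex_derive _ _ _ _ _ _ _ sd.
have lim1 : h^-1 *: ((phi \o s \o shift a) (h *: 1) - (phi \o s) a) @[h --> 0^']
    --> dphi (s a) * ds.
  rewrite (funext QE); apply: cvgM => //.
  rewrite -(@derive_val _ _ _ _ _ _ _ sd); exact: dc.
apply: DeriveDef; first by apply/cvg_ex; eexists; exact: lim1.
by apply: cvg_lim.
Qed.


(* The path t + (s - t) sin^2 h stays in [-1, 1] for all h, so the mean value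
   theorem applies without one-sided derivatives at the endpoints. *)
Lemma link_flat (K s t : R) : 1 <= K ->
  (forall s t : R, `|s| <= 1 -> `|t| <= 1 -> `|dphi s - dphi t| <= K * `|s - t|) ->
  `|s| <= 1 -> `|t| <= 1 -> dphi t = 0 -> `|phi s - phi t| <= 4 * K * (s - t) ^+ 2.
Proof.
move=> K1 lip s1 t1 dt0; pose p (h : R) := t + (s - t) * sin h ^+ 2.
have q01 (h : R) : 0 <= sin h ^+ 2 <= 1.
  by rewrite sqr_ge0 /= -(cos2Dsin2 h) lerDr sqr_ge0.
have p1 h : `|p h| <= 1.
  have := q01 h; rewrite /p; move: s1 t1; rewrite !ler_norml.
  by move: (sin h ^+ 2) => q /andP[? ?] /andP[? ?] /andP[? ?]; apply/andP; split; nra.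
have pd (h : R) : is_derive h 1 p ((s - t) * (2 * sin h * cos h)).
  by rewrite /p; apply: is_derive_eq; rewrite /GRing.scale /=; ring.
have fd (h : R) : is_derive h 1 (phi \o p) (dphi (p h) * ((s - t) * (2 * sin h * cos h))).
  exact: is_derive_link_comp.
have /andP[pi0 pi2] := pihalf_02 R.
have [|x _] := MVT pi0 (fun x _ => fd x).
  by apply: derivable_within_continuous => x _; exact: (@ex_derive _ _ _ _ _ _ _ (fd x)).
have -> : (phi \o p) (pi / 2) = phi s by rewrite /= /p sin_pihalf expr1n mulr1 subrKC.
have -> : (phi \o p) 0 = phi t by rewrite /= /p sin0 expr0n mulr0 addr0.
move=> ->; rewrite subr0 normrM (gtr0_norm pi0).
have dp : `|dphi (p x)| <= K * `|s - t|.
  rewrite -[dphi (p x)]subr0 -dt0 (le_trans (lip _ _ (p1 x) t1)) // ler_wpM2l ?(le_trans ler01) //.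
  rewrite /p addrC addKr normrM; have /andP[q0 q1] := q01 x.
  by rewrite (ger0_norm q0) ler_piMr.
have sc : `|2 * sin x * cos x| <= 2.
  rewrite -mulrA normrM ger0_norm // ler_piMr // normrM.
  by rewrite mulr_ile1 ?normr_ge0 // ler_norml ?sin_geN1 ?sin_le1 ?cos_geN1 ?cos_le1.
(* The three factors bound [dphi] along the path, the speed of the path, and the length pi/2 <= 2 of
   the parameter interval. *)
rewrite (_ : 4 * K * _ = K * `|s - t| * (`|s - t| * 2) * 2); last first.
  by rewrite -[(s - t) ^+ 2]real_normK ?num_real //; ring.
by rewrite ler_pM ?normr_ge0 ?(ltW pi0) ?(ltW pi2) // normrM ler_pM // normrM ler_wpM2l.
Qed.

End Link.

(** * The gradient of the loss at zero weights *)

Section Gradient.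
Local Open Scope classical_set_scope.
Local Open Scope ring_scope.
Variables (R : realType) (phi dphi : R -> R) (c : R) (d k : nat) (js : seq 'I_d).
Hypothesis L : link_function phi dphi c.
Hypotheses (sjs : size js = k) (ujs : uniq js) (k2 : (2 <= k)%N).

Local Notation N := (d + k.-1)%N.
Local Notation S := (@state R d k js).

Lemma input_bits_row n (X : 'M[bool]_(n, d)) i :
  input_bits R X i = input_bits R (row i X) ord0.
Proof. by apply: eq_map => j; rewrite mxE. Qed.

(* Moving the single logit w_{j,m} away from 0 by h replaces its unit weight in the
   uniform average by e^h. *)
Definition tilted_avg (m j : nat) (y : 'rV[bool]_d) (h : R) : R :=
  (prefix_sum R k js m y + (expR h - 1) * S y j) / (m%:R + (expR h - 1)).

Lemma tilted_avgE (m j : 'I_N) (y : 'rV[bool]_d) h : (j < m)%N ->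
  \sum_(a < N | (a < m)%N) softmax (h *: delta_mx j m) a m * S y a = tilted_avg m j y h.
Proof.
move=> jm; have E (a : 'I_N) : expR ((h *: delta_mx j m : 'M[R]_N) a m) =
    1 + (expR h - 1) * (a == j)%:R.
  by rewrite !mxE eqxx andbT; case: eqP => _; rewrite ?mulr1 ?mulr0 ?expR0 ?addr0 // subrKC.
rewrite /softmax; under eq_bigr do rewrite mulrAC.
rewrite -mulr_suml; congr (_ / _).
  under eq_bigr do rewrite E mulrDl mul1r.
  rewrite big_split /=; congr (_ + _).
    rewrite /prefix_sum (big_nat_widen _ _ N) ?big_mkord //; exact: ltnW (ltn_ord m).
  rewrite (bigD1 j) //= eqxx mulr1 big1 ?addr0 // => a /andP[_ /negPf ->].
  by rewrite mulr0 mul0r.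
under eq_bigr do rewrite E.
rewrite big_split /=; congr (_ + _).
  by rewrite -(big_ord_widen N (fun=> 1)) ?sumr_const ?card_ord // ltnW.
by rewrite (bigD1 j) //= eqxx mulr1 big1 ?addr0 // => a /andP[_ /negPf ->]; rewrite mulr0.
Qed.

(** It is a convex combination of signs for every h, as [is_derive_link_comp] requires. *)
Lemma tilted_avg_norm (m j : nat) y h : (j < m < N)%N -> `|tilted_avg m j y h| <= 1.
Proof.
move=> lm; have m1 : 1 <= m%:R :> R by rewrite ler1n; lia.
have e0 := expR_gt0 h.
rewrite /tilted_avg normrM normfV [`|_ + (_ - _)|]gtr0_norm; last by lra.
rewrite ler_pdivrMr ?mul1r; last by lra.
rewrite /prefix_sum big_mkord; have jm : (j < m)%N by lia.
rewrite (bigD1 (Ordinal jm)) //= (_ : _ + _ =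
  expR h * S y j + \sum_(i < m | i != Ordinal jm) S y i); last by ring.
rewrite (le_trans (ler_normD _ _)) // normrM (state_norm R sjs ujs k2) ?(gtr0_norm e0); last by lia.
have : `|\sum_(i < m | i != Ordinal jm) S y i| <= \sum_(i < m | i != Ordinal jm) 1.
  rewrite (le_trans (ler_norm_sum _ _ _)) // ler_sum // => i _.
  by rewrite (state_norm R sjs ujs k2) //; have := ltn_ord i; lia.
have : \sum_(i < m) 1 = m%:R :> R by rewrite sumr_const card_ord.
by rewrite (bigD1 (Ordinal jm)) //=; lra.
Qed.

Lemma tilted_avg0 m j y : tilted_avg m j y 0 = prefix_avg R k js m y.
Proof. by rewrite /tilted_avg expR0 subrr mul0r !addr0. Qed.

Lemma is_derive_tilted_avg (m j : nat) y : (0 < m)%N ->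
  is_derive (0 : R) 1 (tilted_avg m j y) ((S y j - prefix_avg R k js m y) / m%:R).
Proof.
move=> m0; have mne : m%:R != 0 :> R by rewrite pnatr_eq0; lia.
have den : m%:R + (expR 0 - 1) = m%:R :> R by rewrite expR0 subrr addr0.
have numd : is_derive (0 : R) 1 (fun h => prefix_sum R k js m y + (expR h - 1) * S y j) (S y j).
  apply: is_derive_eq; rewrite /GRing.scale /= expR0; ring.
have dend : is_derive (0 : R) 1 (fun h => (m%:R + (expR h - 1))^-1) (- m%:R ^- 2).
  apply: is_derive_eq; first by apply: is_deriveV; rewrite den.
  rewrite /= den /GRing.scale /= expR0; ring.
have := is_deriveM numd dend; rewrite [X in is_derive _ _ X _](_ : _ = tilted_avg m j y) //.
move/is_derive_eq; apply.
rewrite /GRing.scale /= den expR0 /prefix_avg; field.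
by rewrite mne.
Qed.

(** Moving w_{j,m} affects the prediction of node m only, because teacher forcing feeds true states;
    the other nodes contribute the constant [C]. The rest is the chain rule through [tilted_avg]. *)
Lemma grad_loss0 n (X : 'M[bool]_(n, d)) (j m : 'I_N) : (d <= m)%N -> (j < m)%N ->
  grad (loss phi js X) 0 j m =
  m%:R^-1 * (n%:R^-1 * \sum_(i < n) grad_sample k js phi dphi m j (row i X)).
Proof.
move=> dm jm; rewrite /grad mxE; set v := delta_mx j m; have m0 : (0 < m)%N by lia.
pose s (i : 'I_n) := phi \o tilted_avg m j (row i X).
pose C := (2 * n%:R)^-1 * \sum_(m' < N | (d <= m')%N && (m' != m)) \sum_(i < n)
    (let x := true_states k js (input_bits R X i) in next_token phi 0 m' x - x`_m') ^+ 2.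
have lossE h : loss phi js X (h *: v + 0) =
    C + (2 * n%:R)^-1 * \sum_(i < n) (s i h - S (row i X) m) ^+ 2.
  rewrite /loss addr0 (bigD1 m) //= mulrDr addrC; congr (_ * _ + _ * _).
    apply: eq_bigr => m' /andP[_ m'm]; apply: eq_bigr => i _.
    congr ((phi _ - _) ^+ 2); apply: eq_bigr => a _; congr (_ * _).
    have z a' : (h *: v) a' m' = 0 by rewrite !mxE [m' == m]negbTE // andbF mulr0.
    by rewrite /softmax z mxE; congr (_ / _); apply: eq_bigr => a' _; rewrite z mxE.
  apply: eq_bigr => i _; rewrite input_bits_row -/(S _ _).
  by congr ((phi _ - _) ^+ 2); apply: tilted_avgE.
have sd i : is_derive (0 : R) 1 (s i) (dphi (prefix_avg R k js m (row i X)) *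
    ((S (row i X) j - prefix_avg R k js m (row i X)) / m%:R)).
  have := is_derive_link_comp L (a := 0) _ (is_derive_tilted_avg j (row i X) m0).
  rewrite tilted_avg0; apply => h.
  by apply: tilted_avg_norm; rewrite jm ltn_ord.
pose F (h : R) : R^o := C + (2 * n%:R)^-1 * \sum_(i < n) (s i h - S (row i X) m) ^+ 2.
have -> : 'D_v (loss phi js X : _ -> R^o) 0 = 'D_1 F 0.
  have quotE h : h^-1 *: (((loss phi js X : _ -> R^o) \o shift 0) (h *: v) -
      loss phi js X (0 : 'M[R]_N)) = h^-1 *: ((F \o shift 0) (h *: 1) - F 0).
    by rewrite /F /= -!lossE scale0r !addr0 /GRing.scale /= ?mulr1 ?addr0.
  by rewrite /derive (funext quotE).
have s0 i : s i 0 = phi (prefix_avg R k js m (row i X)).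
  by rewrite /s /= tilted_avg0.
pose q (i : 'I_n) : R -> R^o := fun h => (s i h - S (row i X) m) ^+ 2.
pose ds i : R := (S (row i X) j - prefix_avg R k js m (row i X)) / m%:R.
have qd i : is_derive (0 : R) 1 (q i)
    (2 * (s i 0 - S (row i X) m) * (dphi (prefix_avg R k js m (row i X)) * ds i)).
  have := is_deriveB (sd i) (is_derive_cst (S (row i X) m) (0 : R) 1).
  move=> /(is_deriveX 2); rewrite [X in is_derive _ _ X _](_ : _ = q i) //.
  by move/is_derive_eq; apply; rewrite /GRing.scale /= expr1 subr0.
have sumd := is_derive_sum qd.
have all := is_deriveD (is_derive_cst (C : R^o) (0 : R) 1) (is_deriveZ (2 * n%:R)^-1 sumd).
rewrite (_ : F = cst (C : R^o) + (2 * n%:R)^-1 \*: \sum_(i < n) q i); last first.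
  by apply/funext => h; rewrite /F /= fct_sumE.
rewrite (@derive_val _ _ _ _ _ _ _ all) add0r /GRing.scale /= !mulr_sumr.
apply: eq_bigr => i _; rewrite s0 /grad_sample /ds invfM.
by move: (n%:R^-1) (m%:R^-1) => u w; field.
Qed.

End Gradient.

(** * Concentration *)

Section Probability.
Variables (R : realType) (T : finType).
Implicit Types (E F : T -> Prop) (f : T -> R).

Lemma unif_probE E : unif_prob R E = mean (fun x => (`[< E x >])%:R).
Proof.
by rewrite /unif_prob /mean -sum1_card natr_sum big_mkcond; congr (_ / _);
  apply: eq_bigr => x _; rewrite inE; case: asbool.
Qed.

Lemma markov_unif E f : (forall x, 0 <= f x) -> (forall x, E x -> 1 <= f x) ->
  unif_prob R E <= mean f.
Proof.
move=> f0 f1; rewrite unif_probE; apply: le_mean => x.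
by case: asboolP => [/f1|_].
Qed.

Lemma unif_prob_le E F : (forall x, E x -> F x) -> unif_prob R E <= unif_prob R F.
Proof.
move=> EF; rewrite !unif_probE; apply: le_mean => x.
by case: asboolP => [/EF Fx|_]; rewrite ?ler0n //; case: asboolP.
Qed.

Lemma unif_prob_or E F : unif_prob R (fun x => E x \/ F x) <= unif_prob R E + unif_prob R F.
Proof.
rewrite !unif_probE -meanD; apply: le_mean => x.
case: asboolP => [|_]; last by rewrite addr_ge0.
by case=> [Ex|Fx]; [rewrite (asboolT Ex) lerDl|rewrite (asboolT Fx) lerDr].
Qed.

Lemma unif_prob_bigor (I : finType) (P : I -> T -> Prop) (b : R) :
  (forall i, unif_prob R (P i) <= b) ->
  unif_prob R (fun x => exists i, P i x) <= #|I|%:R * b.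
Proof.
move=> Pb; apply: (@le_trans _ _ (\sum_i unif_prob R (P i))); last first.
  by rewrite mulr_natl -sumr_const ler_sum.
under eq_bigr do rewrite unif_probE.
rewrite unif_probE -mean_sum; apply: le_mean => x.
case: asboolP => [[i Pi]|_]; last by rewrite sumr_ge0.
by rewrite (bigD1 i) //= (asboolT Pi) lerDl sumr_ge0.
Qed.

Lemma unif_prob_not E : (0 < #|T|)%N ->
  unif_prob R E = 1 - unif_prob R (fun x => ~ E x).
Proof.
move=> T0; rewrite !unif_probE -[X in X - _](mean_cst T0) -meanB; apply: eq_mean => x.
by rewrite asbool_neg; case: asbool; rewrite ?subrr ?subr0.
Qed.

End Probability.

(** * Hoeffding's inequality for independent uniform rows *)

Section Concentration.
Variables (R : realType) (d n : nat).

(** Independence of the rows: expanding the product of sums gives a sum over choices of one vector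
    per row, that is, over matrices. *)
Lemma mean_prod_rows (F : 'I_n -> 'rV[bool]_d -> R) :
  mean (fun X : 'M[bool]_(n, d) => \prod_i F i (row i X)) = \prod_i mean (F i).
Proof.
rewrite /mean big_split /= bigA_distr_bigA /=; congr (_ * _); last first.
  rewrite prodr_const card_ord exprVn -natrX !card_mx mul1n mulnC expnM.
  by [].
pose g (f : {ffun 'I_n -> 'rV[bool]_d}) : 'M[bool]_(n, d) := \matrix_(i, j) f i ord0 j.
have rg f i : row i (g f) = f i by apply/rowP => j; rewrite !mxE.
rewrite (reindex g) /=; first by apply: eq_bigr => f _; apply: eq_bigr => i _; rewrite rg.
exists (fun X => [ffun i => row i X]) => [f _|X _].
  by apply/ffunP => i; rewrite ffunE rg.
by apply/matrixP => i j; rewrite !mxE ffunE mxE.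
Qed.

(** From exp(-x) >= 1 - x one gets (1 - x) exp(x) <= 1, while (1 - x)(1 + x + 2x^2) = 1 + x^2 (1 -
    2x) >= 1. *)
Lemma expR_quad (x : R) : x <= 2^-1 -> expR x <= 1 + x + 2 * x ^+ 2.
Proof.
move=> x2; have := expR_ge1Dx (- x); rewrite expRN => h.
have e0 := expR_gt0 x.
have : (1 - x) * expR x <= 1 by rewrite -(ler_pdivlMr _ _ e0) mul1r.
have : 0 <= x ^+ 2 by exact: sqr_ge0.
set e := expR x; move=> q h1.
have : (1 - x) * e <= (1 - x) * (1 + x + 2 * x ^+ 2).
  apply: (le_trans h1); rewrite (_ : (1 - x) * _ = 1 + x ^+ 2 * (1 - 2 * x)); last by ring.
  by rewrite lerDl mulr_ge0 //; lra.
by rewrite ler_pM2l //; lra.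
Qed.

Lemma chernoff_unif (f : 'rV[bool]_d -> R) (t : R) : (forall y, `|f y| <= 1) ->
  mean f = 0 -> 0 <= t <= 2 ->
  unif_prob R (fun X : 'M[bool]_(n, d) => n%:R * t <= \sum_i f (row i X)) <=
  expR (- (n%:R * t ^+ 2 / 8)).
Proof.
(* This [l] minimises -l t + 2 l^2, with value -t^2/8; the bound t <= 2 keeps l f at most 1/2, as
   [expR_quad] needs. *)
move=> f1 f0 /andP[t0 t2]; pose l := t / 4.
apply: (@le_trans _ _ (mean (fun X : 'M[bool]_(n, d) =>
    expR (- (l * (n%:R * t))) * \prod_i expR (l * f (row i X))))).
  apply: markov_unif => X.
    by rewrite mulr_ge0 ?expR_ge0 // prodr_ge0 // => i _; exact: expR_ge0.
  move=> h; rewrite -expR_sum -expRD -[X in X <= _]expR0 ler_expR.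
  rewrite -mulr_sumr addrC -mulrBr mulr_ge0 ?subr_ge0 //.
  by rewrite /l divr_ge0.
rewrite meanZ (mean_prod_rows (fun _ y => expR (l * f y))) prodr_const card_ord.
have m1 : mean (fun y => expR (l * f y)) <= expR (2 * l ^+ 2).
  apply: (@le_trans _ _ (1 + 2 * l ^+ 2)); last exact: expR_ge1Dx.
  apply: (@le_trans _ _ (mean (fun y => (1 + 2 * l ^+ 2) + l * f y))).
    apply: le_mean => y; have := f1 y; rewrite ler_norml => /andP[fl fr].
    apply: le_trans (expR_quad _) _; first by rewrite /l; nra.
    have : (l * f y) ^+ 2 <= l ^+ 2.
      by rewrite exprMn ler_piMr ?sqr_ge0 // -[f y ^+ 2]real_normK ?num_real // exprn_ile1.
    lra.
  by rewrite meanD meanZ f0 mulr0 addr0 mean_cst // card_bits_gt0.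
have m0 : 0 <= mean (fun y => expR (l * f y)).
  by rewrite /mean divr_ge0 // sumr_ge0 // => y _; exact: expR_ge0.
apply: (@le_trans _ _ (expR (- (l * (n%:R * t))) * expR (2 * l ^+ 2) ^+ n)).
  by rewrite ler_wpM2l ?expR_ge0 // lerXn2r ?nnegrE ?expR_ge0.
rewrite -expRM_natl -expRD ler_expR /l -mulr_natl; lra.
Qed.

Lemma hoeffding_unif (f : 'rV[bool]_d -> R) (B t : R) : (0 < n)%N -> 0 < B ->
  (forall y, `|f y| <= B) -> 0 <= t <= 4 * B ->
  unif_prob R (fun X : 'M[bool]_(n, d) =>
    t < `|n%:R^-1 * (\sum_i f (row i X)) - mean f|) <=
  2 * expR (- (n%:R * t ^+ 2 / (32 * B ^+ 2))).
Proof.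
move=> n0 B0 fB /andP[t0 tB]; have nR : 0 < n%:R :> R by rewrite ltr0n.
(* Centring doubles the range, hence the scale 2B and the constant 32 B^2 = 8 (2B)^2; s = 1 and s =
   -1 give the two tails. *)
pose g (s : R) y := s * (f y - mean f) / (2 * B).
have c0 := card_bits_gt0 d.
have mB : `|mean f| <= B.
  rewrite (le_trans (ler_norm_mean _)) // -[leRHS](mean_cst (R := R) c0); exact: le_mean.
have gP s : `|s| = 1 -> (forall y, `|g s y| <= 1) /\ mean (g s) = 0.
  move=> s1; split=> [y|].
    have B2 : 0 < 2 * B by rewrite mulr_gt0.
    rewrite /g normrM normfV (gtr0_norm B2) ler_pdivrMr // normrM s1 !mul1r.
    by rewrite (le_trans (ler_normB _ _)) // mulr2n mulrDl mul1r lerD.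
  rewrite (@eq_mean _ _ _ (fun y => (s / (2 * B)) * (f y - mean f))); last first.
    by move=> y; rewrite /g mulrAC.
  by rewrite meanZ meanB mean_cst // subrr mulr0.
have tt : 0 <= t / (2 * B) <= 2.
  by rewrite divr_ge0 ?mulr_ge0 ?(ltW B0) //= ler_pdivrMr ?mulr_gt0 //; lra.
have one s : `|s| = 1 -> unif_prob R (fun X : 'M[bool]_(n, d) =>
    n%:R * (t / (2 * B)) <= \sum_i g s (row i X)) <= expR (- (n%:R * t ^+ 2 / (32 * B ^+ 2))).
  move=> /gP[g1 g0]; apply: (le_trans (chernoff_unif g1 g0 tt)).
  rewrite ler_expR lerN2 le_eqVlt; apply/orP; left; apply/eqP; field.
  by rewrite gt_eqF.
rewrite mulr2n mulrDl mul1r.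
apply: le_trans (lerD (one 1 _) (one (-1) _)); rewrite ?normrN ?normr1 //.
apply: le_trans (unif_prob_or _ _ _); apply: unif_prob_le => X.
have gE s : \sum_i g s (row i X) =
    n%:R * (s * (n%:R^-1 * (\sum_i f (row i X)) - mean f) / (2 * B)).
  rewrite /g -mulr_suml -mulr_sumr sumrB sumr_const card_ord -[mean f *+ n]mulr_natl.
  by field; rewrite !gt_eqF.
rewrite !gE !ler_pM2l // !ler_pM2r ?invr_gt0 ?mulr_gt0 //.
rewrite ltr_normr mul1r mulN1r => /orP[h|h]; [left|right]; exact: ltW.
Qed.

End Concentration.

(** * Inference *)

(** The deviation splits exactly into the imbalance of the two selected weights, bounded by [D], and
    two terms of size at most Z'/Z, where Z' is the mass on the other indices, each e^g times
    lighter than [q0]. *)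
Lemma softmax_select (R : realType) (I : finType) (P : pred I) (w x : I -> R) (q0 q1 : I)
    (g D : R) : P q0 -> P q1 -> q0 != q1 ->
  (forall j, P j -> j != q0 -> j != q1 -> w j + g <= w q0) ->
  `|w q0 - w q1| <= D -> (forall j, P j -> `|x j| <= 1) ->
  `|\sum_(j | P j) expR (w j) / (\sum_(a | P a) expR (w a)) * x j - (x q0 + x q1) / 2| <=
  2 * #|I|%:R * expR (- g) + D.
Proof.
move=> P0 P1 q01 gap wD x1; set Z := \sum_(a | P a) expR (w a).
have split_sum (F : I -> R) : \sum_(j | P j) F j =
    F q0 + F q1 + \sum_(j | [&& P j, j != q0 & j != q1]) F j.
  rewrite (bigD1 q0) //= (bigD1 q1) /=; last by rewrite P1 eq_sym.
  by rewrite addrA; congr (_ + _); apply: eq_bigl => j; rewrite andbA.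
pose Z' := \sum_(j | [&& P j, j != q0 & j != q1]) expR (w j).
have Z'0 : 0 <= Z' by rewrite sumr_ge0 // => j _; exact: expR_ge0.
have ZE : Z = expR (w q0) + expR (w q1) + Z' by rewrite /Z split_sum.
have e0 := expR_gt0 (w q0); have e1 := expR_gt0 (w q1).
have Z0 : 0 < Z by rewrite ZE; lra.
have Z'le : Z' <= #|I|%:R * expR (- g) * Z.
  apply: (@le_trans _ _ (#|I|%:R * expR (- g) * expR (w q0))); last first.
    by rewrite ler_wpM2l ?mulr_ge0 ?expR_ge0 // ZE; lra.
  rewrite -mulrA -expRD addrC mulr_natl -sumr_const /Z' big_mkcond /= ler_sum // => j _.
  case: ifP => [/and3P[Pj j0 j1]|_]; last exact: expR_ge0.
  by rewrite ler_expR; have := gap j Pj j0 j1; lra.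
(* Convexity: the tangent at [a] lies below the exponential. *)
have dexp (a b : R) : expR a - expR b <= expR a * (a - b).
  have := expR_ge1Dx (b - a); have ea := expR_gt0 a.
  rewrite -(ler_pM2l ea) -expRD subrKC; lra.
have eD : `|expR (w q0) - expR (w q1)| <= Z * D.
  have := dexp (w q0) (w q1); have := dexp (w q1) (w q0).
  have D0 : 0 <= D by exact: le_trans wD.
  move: wD; rewrite !ler_norml => /andP[d1 d2] h1 h2; rewrite ZE.
  have : expR (w q1) * (w q1 - w q0) <= expR (w q1) * D by rewrite ler_wpM2l ?(ltW e1) //; lra.
  have : expR (w q0) * (w q0 - w q1) <= expR (w q0) * D by rewrite ler_wpM2l ?(ltW e0).
  have : 0 <= Z' * D by rewrite mulr_ge0.
  have : 0 <= expR (w q0) * D by rewrite mulr_ge0 ?expR_ge0.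
  have : 0 <= expR (w q1) * D by rewrite mulr_ge0 ?expR_ge0.
  by move=> *; apply/andP; split; lra.
pose rest := \sum_(j | [&& P j, j != q0 & j != q1]) expR (w j) * x j.
have restP : `|rest| <= Z'.
  rewrite (le_trans (ler_norm_sum _ _ _)) // ler_sum // => j /and3P[Pj _ _].
  by rewrite normrM gtr0_norm ?expR_gt0 // ler_piMr ?expR_ge0 ?x1.
have -> : \sum_(j | P j) expR (w j) / Z * x j - (x q0 + x q1) / 2 =
    ((expR (w q0) - expR (w q1)) * (x q0 - x q1) / 2 - Z' * (x q0 + x q1) / 2 + rest) / Z.
  under eq_bigr do rewrite mulrAC.
  rewrite -mulr_suml split_sum -/rest.
  have -> : Z' = Z - (expR (w q0) + expR (w q1)) by rewrite ZE; ring.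
  by field; rewrite gt_eqF.
rewrite normrM normfV (gtr0_norm Z0) ler_pdivrMr //.
have x0 := x1 _ P0; have x1' := x1 _ P1.
have b1 : `|(expR (w q0) - expR (w q1)) * (x q0 - x q1) / 2| <= Z * D.
  rewrite normrM normfV normr_nat ler_pdivrMr // normrM ler_pM //.
  by rewrite (le_trans (ler_normB _ _)) //; lra.
have b2 : `|Z' * (x q0 + x q1) / 2| <= Z'.
  rewrite normrM normfV normr_nat ler_pdivrMr // normrM (ger0_norm Z'0) ler_wpM2l //.
  by rewrite (le_trans (ler_normD _ _)) //; lra.
apply: (@le_trans _ _ (Z * D + Z' + Z')); last by lra.
rewrite (le_trans (ler_normD _ _)) // lerD // (le_trans (ler_normB _ _)) // lerD //.
Qed.

Section Inference.
Variables (R : realType) (phi dphi : R -> R) (c : R) (d k : nat) (js : seq 'I_d).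
Hypothesis L : link_function phi dphi c.
Hypotheses (sjs : size js = k) (ujs : uniq js) (k2 : (2 <= k)%N).

Local Notation N := (d + k.-1)%N.
Local Notation S := (@state R d k js).

Lemma child_neq m : (d <= m < N)%N -> child k js false m != child k js true m.
Proof.
move=> lm; rewrite /child -/(tree_nodes k js) nth_uniq ?tree_nodes_uniq //;
  rewrite ?size_tree_nodes //; lia.
Qed.

(** Strong induction on the nodes, keeping every state in [-1, 1] and within [rho] of the truth. As
    16 K a <= 1 means rho <= a, the new error 4K (a + rho)^2 is again at most 16 K a^2 = rho, so
    errors do not grow with depth. *)
Lemma predict_close (K a : R) (W : 'M[R]_N) (g D : R) (p : {set 'I_d}) : 1 <= K ->
  (forall s t : R, `|s| <= 1 -> `|t| <= 1 -> `|dphi s - dphi t| <= K * `|s - t|) ->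
  perm_eq js (enum p) ->
  (forall j m q0 q1 : 'I_N, (d <= m)%N -> (j < m)%N -> val q0 = child k js false m ->
     val q1 = child k js true m ->
     (j != q0 -> j != q1 -> W j m + g <= W q0 m) /\ `|W q0 m - W q1 m| <= D) ->
  2 * N%:R * expR (- g) + D <= a -> 16 * K * a <= 1 ->
  forall (T : nat) (X : 'M[bool]_(T, d)),
    `|predict phi W X - parity R p X| <= 16 * K * a ^+ 2.
Proof.
move=> K1 lip jp Wsel aP a1 T X; set rho := 16 * K * a ^+ 2.
have K0 : 0 < K by apply: lt_le_trans K1.
have rho0 : 0 <= rho by rewrite mulr_ge0 ?sqr_ge0 // mulr_ge0 // ltW.
suff main i : `|(generate (next_token phi W) (input_bits R X i))`_N.-1 -
    S (row i X) N.-1| <= rho.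
  (* The norm of a matrix, if nonzero, is attained at an entry, so a single test input suffices. *)
  set M := predict phi W X - _; rewrite [leLHS]/Num.norm /=.
  have [->|/mx_norm_neq0[[i' i] ->]] // := eqVneq (mx_norm M) 0; rewrite /M /= {M}.
  have := main i; rewrite (state_root R sjs ujs k2 (row i X) jp) !mxE.
  by under eq_bigr do rewrite mxE.
set y := row i X; rewrite input_bits_row -/y.
have sz : size (input_bits R y ord0) = d by rewrite size_map size_enum_ord.
have [gs gi gm] := generateP (k := k) (next_token phi W) sz.
set s := generate _ _ in gs gi gm *.
suff close j : (j < N)%N -> `|s`_j| <= 1 /\ `|s`_j - S y j| <= rho.
  by apply: (close _ _).2; lia.
elim/ltn_ind: j => j IH jN; have [jd|jd] := ltnP j d.
  rewrite gi //; pose j' := Ordinal jd.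
  rewrite -[j]/(val j') (state_input R k js y j') (nth_map j') ?size_enum_ord // nth_ord_enum.
  by rewrite subrr normr0 /sgn normrX normrN1 expr1n.
pose m := Ordinal jN; have lm : (d <= j < N)%N by rewrite jd jN.
have c0 := child_lt sjs ujs k2 false lm; have c1 := child_lt sjs ujs k2 true lm.
pose q0 : 'I_N := Ordinal (ltn_trans c0 jN); pose q1 : 'I_N := Ordinal (ltn_trans c1 jN).
have q01 : q0 != q1 by rewrite -val_eqE child_neq.
have sE : s`_j = phi (\sum_(a < N | (a < m)%N) softmax W a m * s`_a).
  rewrite -[j]/(val m) gm //; congr (phi _); apply: eq_bigr => b bm.
  by rewrite nth_take.
have s1 (b : 'I_N) : (b < m)%N -> `|s`_b| <= 1 by move=> bm; case: (IH b bm (ltn_ord b)).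
have sel0 (b : 'I_N) bm := Wsel b m q0 q1 jd bm erefl erefl.
have sel := @softmax_select R _ (fun a : 'I_N => (a < m)%N) (fun a => W a m)
  (fun a => s`_a) q0 q1 g D c0 c1 q01 (fun b bm => (sel0 b bm).1) (sel0 q0 c0).2 s1.
rewrite -/(softmax _ _ _) card_ord in sel.
set zt := \sum_(a < N | (a < m)%N) softmax W a m * s`_a in sE.
have {}sel : `|zt - (s`_q0 + s`_q1) / 2| <= a by apply: le_trans aP; exact: sel.
have zt1 : `|zt| <= 1.
  have Z0 : 0 < \sum_(b < N | (b < m)%N) expR (W b m).
    rewrite (bigD1 q0) //= ltr_wpDr ?expR_gt0 // sumr_ge0 // => b _; exact: expR_ge0.
  rewrite (le_trans (ler_norm_sum _ _ _)) //.
  apply: (@le_trans _ _ (\sum_(b < N | (b < m)%N) softmax W b m)).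
    apply: ler_sum => b bm; rewrite normrM ger0_norm ?ler_piMr ?s1 //;
      by rewrite divr_ge0 ?expR_ge0 // ltW.
  by rewrite /softmax -mulr_suml divff // gt_eqF.
split; first by rewrite sE; exact: link_norm L _ zt1.
have [_ r0] := IH _ c0 (ltn_ord q0); have [_ r1] := IH _ c1 (ltn_ord q1).
pose zs := (S y q0 + S y q1) / 2.
have [x0 x1] : (S y q0 == 1) || (S y q0 == -1) /\ (S y q1 == 1) || (S y q1 == -1).
  by rewrite -!eqf_sqr !expr1n !(state_sqr R sjs ujs k2) ?eqxx ?ltn_ord.
have [zs1 dz pz] : [/\ `|zs| <= 1, dphi zs = 0 & phi zs = S y q0 * S y q1].
  rewrite /zs; case/orP: x0 => /eqP->; case/orP: x1 => /eqP->.
  - by rewrite (_ : (1 + 1) / 2 = 1) ?normr1 ?(link_d1 L) ?(link_1 L) ?mulr1 //; field.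
  - by rewrite subrr mul0r normr0 (link_d0 L) (link_0 L) mul1r.
  - by rewrite addNr mul0r normr0 (link_d0 L) (link_0 L) mulr1.
  - by rewrite (_ : (-1 + -1) / 2 = -1) ?normrN1 ?(link_dN1 L) ?(link_N1 L) //;
      [rewrite mulrNN mulr1|field].
rewrite sE (state_inner R sjs ujs k2 y lm) -[child k js false j]/(val q0).
rewrite -[child k js true j]/(val q1) -pz.
have zz : `|zt - zs| <= a + rho.
  rewrite (_ : zt - zs = (zt - (s`_q0 + s`_q1) / 2) +
    ((s`_q0 - S y q0) + (s`_q1 - S y q1)) / 2); last by rewrite /zs; field.
  rewrite (le_trans (ler_normD _ _)) // lerD // normrM normfV normr_nat ler_pdivrMr //.
  by rewrite (le_trans (ler_normD _ _)) //; move: r0 r1 => /=; lra.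
rewrite (le_trans (link_flat L K1 lip zt1 zs1 dz)) //.
have a0 : 0 <= a by apply: le_trans sel.
apply: (@le_trans _ _ (4 * K * (a + rho) ^+ 2)).
  rewrite ler_wpM2l ?mulr_ge0 ?(ltW K0) // -[(zt - zs) ^+ 2]real_normK ?num_real //.
  by rewrite lerXn2r ?nnegrE ?addr_ge0.
have -> : 4 * K * (a + rho) ^+ 2 = 4 * K * a ^+ 2 * (1 + 16 * K * a) ^+ 2.
  by rewrite /rho; ring.
have -> : rho = 4 * K * a ^+ 2 * 2 ^+ 2 by rewrite /rho; ring.
rewrite ler_wpM2l ?mulr_ge0 ?sqr_ge0 ?(ltW K0) // lerXn2r ?nnegrE //.
  by rewrite addr_ge0 // !mulr_ge0 // ltW.
lra.
Qed.

End Inference.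

(** * The one-step update *)

Section Asymptotics.
Local Open Scope classical_set_scope.
Local Open Scope ring_scope.
Variable R : realType.

Lemma powR_eventually_ge (e A : R) : 0 < e -> \forall n \near \oo, A <= n%:R `^ e.
Proof.
move=> e0; apply: filterS (nbhs_infty_ger ((Num.max A 0) `^ e^-1)) => n An.
have A0 : 0 <= Num.max A 0 by rewrite le_max lexx orbT.
apply: (@le_trans _ _ (Num.max A 0)); first by rewrite le_max lexx.
rewrite -[leLHS]powRr1 // -[X in _ `^ X <= _](mulVf (lt0r_neq0 e0)) powRrM.
by apply: ge0_ler_powR; rewrite ?nnegrE ?powR_ge0 ?ler0n // ltW.
Qed.

Lemma expR_powR_eventually_ge (e a A : R) (p : nat) : 0 < e -> 0 < a ->
  \forall n \near \oo, A * n%:R ^+ p <= expR (a * n%:R `^ e).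
Proof.
(* The Taylor term of degree M + 1 grows at least like n^(p+1), since e (M + 1) >= p + 1; the spare
   power of n absorbs [A]. *)
move=> e0 a0; pose M := Num.truncn (p.+1%:R / e).
have Me : p.+1%:R <= e * M.+1%:R.
  by rewrite mulrC -ler_pdivrMr // ltW // truncnS_gt.
apply: filterS2 (nbhs_infty_ger (1 : R)) (nbhs_infty_ger (A * (M.+1)`!%:R / a ^+ M.+1)) => n n1 nA.
have f0 : 0 < (M.+1)`!%:R :> R by rewrite ltr0n fact_gt0.
have y0 : 0 <= a * n%:R `^ e by rewrite mulr_ge0 ?powR_ge0 // ltW.
apply: (@le_trans _ _ ((a * n%:R `^ e) ^+ M.+1 / (M.+1)`!%:R)); last first.
  by apply: le_trans (expR_ge1Dxn M y0); rewrite lerDr.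
rewrite exprMn -(powR_mulrn M.+1 (powR_ge0 n%:R e)) -powRrM ler_pdivlMr //.
apply: (@le_trans _ _ (a ^+ M.+1 * n%:R ^+ p.+1)); last first.
  by rewrite ler_wpM2l ?exprn_ge0 ?(ltW a0) // -(powR_mulrn p.+1 (ler0n R n)) ler_powR.
rewrite mulrAC (exprS n%:R p) mulrA ler_wpM2r ?exprn_ge0 ?ler0n //.
by rewrite [leRHS]mulrC -ler_pdivrMr ?exprn_gt0.
Qed.

End Asymptotics.

Section OneStep.
Variables (R : realType) (phi dphi : R -> R) (c K : R) (d k v : nat) (js : seq 'I_d).
Hypothesis L : link_function phi dphi c.
Hypotheses (K1 : 1 <= K)
  (phiE : forall t : R, `|t| <= 1 -> `|phi t - (-1 + c * t ^+ 2)| <= K * `|t| ^+ 4)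
  (dphiE : forall t : R, `|t| <= 1 -> `|dphi t - 2 * c * t| <= K * `|t| ^+ 3)
  (dphi_lip : forall s t : R, `|s| <= 1 -> `|t| <= 1 -> `|dphi s - dphi t| <= K * `|s - t|).
Hypotheses (sjs : size js = k) (ujs : uniq js) (k2 : (2 <= k)%N).

Local Notation N := (d + k.-1)%N.
Local Notation g := (grad_sample k js phi dphi).

Lemma grad_sample_norm m j y : (0 < m < N)%N -> (j < N)%N -> `|g m j y| <= 4 * K.
Proof.
move=> lm jN; have z1 : `|prefix_avg R k js m y| <= 1.
  by apply: prefix_avg_norm => //; lia.
rewrite /grad_sample !normrM (_ : 4 * K = 2 * K * 2); last by ring.
have xm : `|state R k js y m| = 1 by apply: state_norm => //; lia.
have xj : `|state R k js y j| = 1 by apply: state_norm => //; lia.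
rewrite !ler_pM ?mulr_ge0 //.
- by rewrite (le_trans (ler_normB _ _)) // xm; have := link_norm L z1; lra.
- rewrite -[dphi _]subr0 -(link_d0 L) (le_trans (dphi_lip z1 _)) ?normr0 // subr0.
  by rewrite ler_piMr // (le_trans ler01).
- by rewrite (le_trans (ler_normB _ _)) // xj; lra.
Qed.

Hypotheses (kd : (k <= d)%N) (kv : k = (2 ^ v)%N).

(** The deterministic half of the argument: [y] stands for d^(eps/16), and every requirement that d
    be large is an explicit inequality. [predict_close] is applied with a = C1/y. *)
Lemma one_step_predict (Cg ce Ce y eta : R) (p : {set 'I_d}) n (X : 'M[bool]_(n, d))
    (G : 'M[R]_N -> 'M[R]_N) :
  perm_eq js (enum p) -> 0 < Cg -> 0 < ce -> 0 < Ce -> 1 <= y ->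
  ce * (d%:R ^+ 2 * y) <= eta <= Ce * (d%:R ^+ 2 * y) ->
  (forall j m : 'I_N, (d <= m)%N -> (j < m)%N ->
     `|G 0 j m - grad (loss phi js X) 0 j m| <= Cg / (d%:R ^+ 2 * y ^+ 2)) ->
  (forall j m : 'I_N, (d <= m)%N -> (j < m)%N ->
     `|n%:R^-1 * (\sum_i g m j (row i X)) - mean (g m j)| <= (d%:R * y ^+ 2)^-1) ->
  98 * (K ^+ 2 + 3 * c * K + 2 * c ^+ 2 + 2 * K) <= c * Num.sqrt d%:R ->
  16 * (Cg + 1) <= c * y ->
  4 * d%:R * y <= expR (ce * c / 8 * y) ->
  16 * K * (1 + 2 * Ce * (Cg + 1)) <= y ->
  forall (T : nat) (Xt : 'M[bool]_(T, d)),
    `|predict phi (one_step eta G) Xt - parity R p Xt| <=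
    16 * K * (1 + 2 * Ce * (Cg + 1)) ^+ 2 / y ^+ 2.
Proof.
move=> jp Cg0 ce0 Ce0 y1 /andP[eta1 eta2] oracle good ev1 ev2 ev3 ev4 T Xt.
have c0 := link_c_gt0 L.
have dpos : (0 < d)%N by rewrite (leq_trans _ kd) // ltnW.
have d0 : 0 < d%:R :> R by rewrite ltr0n.
have N2d : (N <= d.*2)%N by rewrite -addnn leq_add2l (leq_trans (leq_pred k)).
have y0 : 0 < y by lra.
have eta0 : 0 <= eta by rewrite (le_trans _ eta1) // !mulr_ge0 ?exprn_ge0 // ltW.
set C1 := 1 + 2 * Ce * (Cg + 1).
have -> : 16 * K * C1 ^+ 2 / y ^+ 2 = 16 * K * (C1 / y) ^+ 2 by field; rewrite gt_eqF.
set Lam := _ + 2 * K in ev1.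
(* Total error of a gradient entry: the oracle error, plus the sampling error 1/(d y^2) weighted by
   1/m <= 1/d. *)
pose dl := (Cg + 1) / (d%:R ^+ 2 * y ^+ 2).
apply: (predict_close L sjs ujs k2 (K := K) (g := ce * c / 8 * y)
  (D := 2 * Ce * (Cg + 1) / y)) => //.
- move=> j m q0 q1 dm jm q0E q1E.
  have lm : (d <= m < N)%N by rewrite dm ltn_ord.
  have m0 : 0 < m%:R :> R by rewrite ltr0n (leq_trans dpos).
  have mdR : d%:R <= m%:R :> R by rewrite ler_nat.
  have m2d : m%:R <= 2 * d%:R :> R by rewrite -natrM ler_nat mul2n (leq_trans (ltnW (ltn_ord m))).
  have q0m : (q0 < m)%N by rewrite [nat_of_ord q0]q0E child_lt.
  have q1m : (q1 < m)%N by rewrite [nat_of_ord q1]q1E child_lt.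
  have est (i : 'I_N) : (i < m)%N -> `|G 0 i m - m%:R^-1 * mean (g m i)| <= dl.
    move=> im; rewrite (_ : _ - _ = (G 0 i m - grad (loss phi js X) 0 i m) +
       m%:R^-1 * (n%:R^-1 * (\sum_i0 g m i (row i0 X)) - mean (g m i))); last first.
      by rewrite (grad_loss0 L) //; ring.
    rewrite (le_trans (ler_normD _ _)) // /dl mulrDl lerD ?oracle // normrM normfV normr_nat.
    apply: (@le_trans _ _ (d%:R^-1 * (d%:R * y ^+ 2)^-1)).
      by rewrite ler_pM ?invr_ge0 ?ler0n ?good // lef_pV2 ?posrE.
    by rewrite div1r -invfM mulrA -expr2.
  have WE (i : 'I_N) : one_step eta G i m = - (eta * G 0 i m) by rewrite !mxE add0r.
  rewrite !WE; split=> [jq0 jq1|].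
    have jc0 : nat_of_ord j != child k js false m by rewrite -q0E -val_eqE in jq0 *.
    have jc1 : nat_of_ord j != child k js true m by rewrite -q1E -val_eqE in jq1 *.
    have := grad_sample_gap sjs ujs k2 false c0 phiE dphiE lm jm jc0 jc1.
    rewrite -q0E -/Lam => gap.
    have gap1 : c / m%:R <= mean (g m j) - mean (g m q0).
      apply: le_trans gap; rewrite ler_wpM2r ?invr_ge0 ?(ltW m0) //.
      suff : 98 * Lam / Num.sqrt m%:R <= c by lra.
      rewrite ler_pdivrMr ?sqrtr_gt0 // (le_trans ev1) // ler_wpM2l ?(ltW c0) //.
      by rewrite ler_sqrt // ltW.
    (* As m <= 2d, the gap c/m^2 is at least c/(4d^2). The errors use up at most half of it, and
       [eta] turns the rest into a logit gap of at least (ce c/8) y. *)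
    have gap2 : c / (4 * d%:R ^+ 2) <= m%:R^-1 * (mean (g m j) - mean (g m q0)).
      apply: (@le_trans _ _ (m%:R^-1 * (c / m%:R))); last by rewrite ler_wpM2l ?invr_ge0 ?(ltW m0).
      rewrite [leRHS]mulrCA ler_wpM2l ?(ltW c0) // -invfM lef_pV2 ?posrE ?mulr_gt0 ?exprn_gt0 //.
      by rewrite (_ : 4 * d%:R ^+ 2 = (2 * d%:R) * (2 * d%:R)); [rewrite ler_pM ?ler0n|ring].
    have dl8 : 2 * dl <= c / (8 * d%:R ^+ 2).
      rewrite /dl (_ : 2 * _ = (2 * (Cg + 1) / y ^+ 2) / d%:R ^+ 2); last first.
        by field; rewrite !gt_eqF.
      rewrite (_ : c / _ = c / 8 / d%:R ^+ 2); last by field; rewrite gt_eqF.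
      rewrite ler_wpM2r ?invr_ge0 ?exprn_ge0 ?ler0n //.
      rewrite ler_pdivrMr ?exprn_gt0 //.
      have : c * y <= c * y ^+ 2 by rewrite ler_wpM2l ?(ltW c0) // expr2 ler_peMr // ltW.
      lra.
    have e1 := est _ jm; have e2 := est _ q0m; move: e1 e2.
    rewrite !ler_norml => /andP[e1 _] /andP[_ e2].
    have : eta * (c / (8 * d%:R ^+ 2)) <= eta * (G 0 j m - G 0 q0 m).
      rewrite ler_wpM2l //.
      have -> : c / (8 * d%:R ^+ 2) = c / (4 * d%:R ^+ 2) - c / (8 * d%:R ^+ 2).
        by field; rewrite gt_eqF.
      lra.
    have : ce * (d%:R ^+ 2 * y) * (c / (8 * d%:R ^+ 2)) <= eta * (c / (8 * d%:R ^+ 2)).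
      by rewrite ler_wpM2r // divr_ge0 ?mulr_ge0 ?exprn_ge0 ?ler0n // ltW.
    have -> : ce * (d%:R ^+ 2 * y) * (c / (8 * d%:R ^+ 2)) = ce * c / 8 * y.
      by field; rewrite gt_eqF.
    lra.
  (* The expectations cancel exactly, so only errors of size 2 dl separate the two logits after
     scaling by [eta]. *)
  have sym : mean (g m q0) = mean (g m q1).
    rewrite [nat_of_ord q0]q0E [nat_of_ord q1]q1E.
    exact: (mean_grad_sample_children sjs ujs k2 phi dphi kv lm).
  rewrite (_ : _ - _ = eta * (G 0 q1 m - G 0 q0 m)); last by ring.
  rewrite normrM (ger0_norm eta0).
  apply: (@le_trans _ _ (Ce * (d%:R ^+ 2 * y) * (2 * dl))); last first.
    by rewrite /dl le_eqVlt; apply/orP; left; apply/eqP; field; rewrite !gt_eqF.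
  apply: ler_pM => //; have := est _ q0m; have := est _ q1m.
  rewrite sym !ler_norml => /andP[? ?] /andP[? ?]; apply/andP; split; lra.
- have : 2 * N%:R * expR (- (ce * c / 8 * y)) <= y^-1.
    rewrite expRN ler_pdivrMr ?expR_gt0 // [leRHS]mulrC ler_pdivlMr //.
    apply: le_trans ev3; rewrite ler_wpM2r ?(ltW y0) //.
    have : N%:R <= 2 * d%:R :> R by rewrite -natrM ler_nat mul2n.
    lra.
  rewrite /C1 mulrDl mul1r; lra.
- by rewrite mulrA ler_pdivrMr // mul1r.
Qed.

End OneStep.

Lemma grad_oracle_entrywise (R : realType) (d k : nat) (delta : R)
    (l : 'M[R]_(d + k.-1) -> R) (G : 'M[R]_(d + k.-1) -> 'M[R]_(d + k.-1)) :
  grad_oracle delta l G -> entrywise_grad_oracle delta l G.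
Proof.
move=> GO W j m dm jm; apply: le_trans (GO W).
rewrite -sqrtr_sqr ler_sqrt ?sumr_ge0 //; last first.
  by move=> *; rewrite sumr_ge0 // => *; exact: sqr_ge0.
rewrite (bigD1 m) //= (bigD1 j) //= -addrA lerDl addr_ge0 ?sumr_ge0 // => *.
  exact: sqr_ge0.
by rewrite sumr_ge0 // => *; exact: sqr_ge0.
Qed.

(** The last inequality serves the union bound: at most (2d)^2 entries, two tails each, with
    Hoeffding exponent of order n/(d y^2)^2, which is at least of order y^12; the target is y^8 =
    d^(eps/2). *)
Lemma eventually_large (R : realType) (eps a b A B : R) : 0 < eps -> 0 < a -> 0 < b ->
  exists d0 : nat, forall d, (d0 <= d)%N -> let y := d%:R `^ (eps / 16) in
  [/\ 1 <= y, A <= y, B <= d%:R, 4 * d%:R * y <= expR (b * y) &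
      8 * d%:R ^+ 2 * expR (- (a * y ^+ 12)) <= expR (- y ^+ 8)].
Proof.
move=> eps0 a0 b0; have e0 : 0 < eps / 16 by rewrite divr_gt0.
have b20 : 0 < b / 2 by rewrite divr_gt0.
(* The summand 8/b^2 yields y <= exp(b y/2) through the quadratic Taylor term, and 2/a yields 2 y^11
   <= a y^12. *)
have [d1 _ P1] := powR_eventually_ge (1 + `|A| + 8 / b ^+ 2 + 2 / a) e0.
have [d2 _ P2] := nbhs_infty_ger B.
have [d3 _ P3] := expR_powR_eventually_ge 4 1 e0 b20.
have [d4 _ P4] := expR_powR_eventually_ge 8 2 e0 (@ltr01 R).
exists (maxn (maxn d1 d2) (maxn d3 d4)) => d; rewrite !geq_max.
case/andP => /andP[/P1 /= l1 /P2 /= l2] /andP[/P3 /= l3 /P4 /= l4].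
move: l1 l3 l4; rewrite mul1r expr1; set y := d%:R `^ (eps / 16) => l1 l3 l4.
have n0 := normr_ge0 A; have n1 := ler_norm A.
have p1 : 0 < 8 / b ^+ 2 by rewrite divr_gt0 ?exprn_gt0.
have p2 : 0 < 2 / a by rewrite divr_gt0.
have y1 : 1 <= y by lra.
split=> //; first by lra.
  have yb : y <= expR (b / 2 * y).
    have by0 : 0 <= b / 2 * y by rewrite mulr_ge0 ?(ltW b20) //; lra.
    apply: le_trans (expR_ge1Dxn 1 by0).
    have : 8 <= b ^+ 2 * y by rewrite mulrC -ler_pdivrMr ?exprn_gt0 //; lra.
    have -> : (b / 2 * y) ^+ 2 / 2`!%:R = b ^+ 2 * y * y / 8.
      by rewrite (_ : 2`! = 2%N) //; field.
    have yy : 0 <= y by lra.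
    by move/(ler_wpM2r yy); lra.
  have -> : b * y = b / 2 * y + b / 2 * y by field.
  by rewrite expRD ler_pM ?mulr_ge0 ?ler0n //; lra.
apply: (@le_trans _ _ (expR y * expR (- (a * y ^+ 12)))).
  by rewrite ler_wpM2r ?expR_ge0.
rewrite -expRD ler_expR.
have ay : 2 <= a * y by rewrite mulrC -ler_pdivrMr //; lra.
have y8 : y <= y ^+ 8 by rewrite -[leLHS]expr1 ler_weXn2l.
have y11 : y ^+ 8 <= y ^+ 11 by rewrite ler_weXn2l.
have : 2 * y ^+ 11 <= a * y ^+ 12.
  by rewrite (exprS y 11) mulrA ler_wpM2r // exprn_ge0 //; lra.
lra.
Qed.

Unset Implicit Arguments.
Set Strict Implicit.

Theorem theorem5 (R : realType) (phi dphi : R -> R) (c : R)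
    (eps Cn Cg ce Ce : R) :
  link_function phi dphi c ->
  0 < eps -> 0 < Cn -> 0 < Cg -> 0 < ce -> 0 < Ce ->
  exists (C : R) (d0 : nat), 0 < C /\
  forall (d k v n : nat) (eta : R) (p : {set 'I_d}) (js : seq 'I_d)
    (G : 'M[bool]_(n, d) -> 'M[R]_(d + k.-1) -> 'M[R]_(d + k.-1)),
  (d0 <= d)%N -> (2 <= k)%N -> (k <= d)%N -> k = (2 ^ v)%N ->
  Cn * d%:R `^ (2 + eps) <= n%:R ->
  ce * d%:R `^ (2 + eps / 16) <= eta <= Ce * d%:R `^ (2 + eps / 16) ->
  #|p| = k -> perm_eq js (enum p) ->
  (let delta := Cg * d%:R `^ (- 2 - eps / 8) in
   (forall X, grad_oracle delta (loss phi js X) (G X)) \/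
   (forall X, entrywise_grad_oracle delta (loss phi js X) (G X))) ->
  1 - expR (- d%:R `^ (eps / 2)) <=
  unif_prob R (fun X : 'M[bool]_(n, d) =>
    forall (T : nat) (Xtest : 'M[bool]_(T, d)),
      `|predict phi (one_step eta (G X)) Xtest - parity R p Xtest|
        <= C * d%:R `^ (- (eps / 8))).
Proof.
move=> L eps0 Cn0 Cg0 ce0 Ce0.
have [K [K1 phiE dphiE lip]] := link_bounds L.
have c0 := link_c_gt0 L; have K0 : 0 < K by lra.
pose C1 := 1 + 2 * Ce * (Cg + 1).
have C10 : 0 < C1 by rewrite addr_gt0 // !mulr_gt0 //; lra.
pose Lam := 98 * (K ^+ 2 + 3 * c * K + 2 * c ^+ 2 + 2 * K).
(* The coefficient of y^12 in Hoeffding's exponent, with the bound B = 4K of [grad_sample_norm]. *)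
pose a := Cn / (32 * (4 * K) ^+ 2).
have a0 : 0 < a by rewrite divr_gt0 // mulr_gt0 // exprn_gt0 // mulr_gt0.
have b0 : 0 < ce * c / 8 by rewrite divr_gt0 // mulr_gt0.
have [d0 large] := eventually_large (16 * (Cg + 1) / c + 16 * K * C1) ((Lam / c) ^+ 2) eps0 a0 b0.
exists (16 * K * C1 ^+ 2), d0; split; first by rewrite !mulr_gt0 ?exprn_gt0.
move=> d k v n eta p js G d0d k2 kd kv nE etaE pk jp oracle0.
have sjs : size js = k by rewrite (perm_size jp) -cardE.
have ujs : uniq js by rewrite (perm_uniq jp) enum_uniq.
have dpos : (0 < d)%N by rewrite (leq_trans _ kd) // ltnW.
have D0 : 0 < d%:R :> R by rewrite ltr0n.
have := large d d0d; set y := d%:R `^ (eps / 16) => -[y1 yA dB ev3 tail].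
have y0 : 0 < y by lra.
(* All exponents are multiples of eps/16 up to the factor d^2, so from here on y^2, y^8 and y^16
   replace d^(eps/8), d^(eps/2) and d^eps. *)
have powy r m : r = eps / 16 * m%:R -> d%:R `^ r = y ^+ m :> R.
  by move=> ->; rewrite powRrM powR_mulrn // powR_ge0.
have pow2 (r : R) : d%:R `^ (2 + r) = d%:R ^+ 2 * d%:R `^ r.
  rewrite powRD; last by rewrite (gt_eqF D0) implybT.
  by rewrite powR_mulrn // ler0n.
have delta_eq : Cg * d%:R `^ (- 2 - eps / 8) = Cg / (d%:R ^+ 2 * y ^+ 2).
  by rewrite -opprD powRN pow2 (powy _ 2) //; field.
rewrite delta_eq in oracle0.
have oracle X : entrywise_grad_oracle (Cg / (d%:R ^+ 2 * y ^+ 2)) (loss phi js X) (G X).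
  by case: oracle0 => oracle0; [apply: grad_oracle_entrywise|].
have bound_eq : d%:R `^ (- (eps / 8)) = (y ^+ 2)^-1 :> R.
  by rewrite powRN (powy _ 2) //; field.
rewrite bound_eq (powy _ 8); last by field.
move: etaE nE; rewrite !pow2 -/y (powy _ 16); last by field.
move=> etaE nE.
have n0 : (0 < n)%N by rewrite -(ltr0n R) (lt_le_trans _ nE) // !mulr_gt0 ?exprn_gt0.
have nR : 0 < n%:R :> R by rewrite ltr0n.
have ev1 : Lam <= c * Num.sqrt d%:R.
  by rewrite mulrC -ler_pdivrMr // (le_trans (ler_norm _)) // -sqrtr_sqr ler_sqrt // ltW.
have yA1 : 0 < 16 * (Cg + 1) / c by rewrite divr_gt0 ?mulr_gt0 //; lra.
have yA2 : 0 < 16 * K * C1 by rewrite !mulr_gt0.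
have ev2 : 16 * (Cg + 1) <= c * y by rewrite [leRHS]mulrC -ler_pdivrMr //; lra.
have ev4 : 16 * K * C1 <= y by lra.
pose g := grad_sample k js phi dphi.
pose t : R := (d%:R * y ^+ 2)^-1.
(* These events involve neither the oracle nor the test inputs, so outside them the bound holds for
   adversarial answers and all test sets at once. For masked pairs the event is empty. *)
pose Bad (jm : 'I_(d + k.-1) * 'I_(d + k.-1)) (X : 'M[bool]_(n, d)) :=
  (d <= jm.2)%N && (jm.1 < jm.2)%N /\
  t < `|n%:R^-1 * (\sum_i g jm.2 jm.1 (row i X)) - mean (g jm.2 jm.1)|.
have T0 : (0 < #|{: 'M[bool]_(n, d)}|)%N by apply/card_gt0P; exists 0.
rewrite unif_prob_not // lerD2l lerN2.
have badP : unif_prob R (fun X => exists jm, Bad jm X) <= expR (- y ^+ 8).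
  have B0 : 0 < 4 * K by rewrite mulr_gt0.
  have t4 : 0 <= t <= 4 * (4 * K).
    have : t <= 1.
      rewrite invf_le1 ?mulr_gt0 ?exprn_gt0 // mulr_ege1 ?ler1n // expr_ge1 // ltW //.
    by rewrite invr_ge0 mulr_ge0 ?ler0n ?exprn_ge0 ?(ltW y0) //=; lra.
  apply: le_trans (unif_prob_bigor (b := 2 * expR (- (n%:R * t ^+ 2 / (32 * (4 * K) ^+ 2)))) _) _.
    case=> j m; rewrite /Bad /=; case: (boolP ((d <= m)%N && (j < m)%N)) => [/andP[dm jm]|_].
      apply: le_trans (hoeffding_unif (f := g m j) n0 B0 _ t4).
        by apply: unif_prob_le => X [].
      move=> u; apply: (grad_sample_norm L K1 lip sjs ujs k2).
        by rewrite (leq_trans dpos dm) ltn_ord.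
      exact: ltn_ord.
    apply: (@le_trans _ _ 0); last by rewrite mulr_ge0 ?expR_ge0.
    by rewrite unif_probE /mean big1 ?mul0r // => X _; case: asboolP => // -[].
  rewrite card_prod card_ord natrM.
  apply: le_trans tail.
  have N2 : (d + k.-1)%:R <= 2 * d%:R :> R.
    by rewrite -natrM ler_nat mul2n -addnn leq_add2l (leq_trans (leq_pred k)).
  have -> : 8 * d%:R ^+ 2 * expR (- (a * y ^+ 12)) =
    (2 * d%:R) * (2 * d%:R) * (2 * expR (- (a * y ^+ 12))) by ring.
  rewrite !ler_pM ?mulr_ge0 ?ler0n ?expR_ge0 // ler_expR lerN2.
  have -> : a * y ^+ 12 = (Cn * (d%:R ^+ 2 * y ^+ 16)) * t ^+ 2 / (32 * (4 * K) ^+ 2).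
    by rewrite /a /t; field; rewrite !gt_eqF.
  by rewrite !ler_wpM2r ?sqr_ge0 // invr_ge0 mulr_ge0 ?sqr_ge0.
apply: le_trans badP; apply: unif_prob_le => X nE0; apply: contrapT => good; apply: nE0.
apply: (one_step_predict L K1 phiE dphiE lip sjs ujs k2 kd kv (X := X)
  jp Cg0 ce0 Ce0 y1 etaE) => //.
  exact: oracle.
move=> j m dm jm; rewrite leNgt; apply/negP => bad.
by apply: good; exists (j, m); split; [apply/andP|exact: bad].
Qed.
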